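(* Let $n\geq 1$ be an integer and let $a_0>0$ be real. For $0<\mu<1$ put $$\rho(\mu)=\frac{n\mu}{2a_0}\left(\left(\frac{1+\mu}{1-\mu}\right)^{\frac{1-\mu}{2}}+\left(\frac{1-\mu}{1+\mu}\right)^{\frac{1+\mu}{2}}\right).$$ Let $\mu_0$ be a real number with $0<\mu_0<1$ and $\rho(\mu_0)=\sin\frac{\pi\mu_0}{2}$, and let $\mu$ be a real number with $0<\mu<\mu_0$. If $p\in\mathcal{H}[a_0,n]$ satisfies $p(z)\neq0$ for all $z\in\mathbb{U}$ and $$\left|\arg\left(p(z)-\frac{zp'(z)}{p(z)}\right)\right|<\arctan\left(\frac{\rho(\mu)\cos\frac{\pi\mu}{2}}{1-\rho(\mu)\sin\frac{\pi\mu}{2}}\right)-\frac{\pi}{2}\mu\qquad\text{for all }z\in\mathbb{U},$$ then $p\in\mathcal{STH}[a_0,n](\mu)$, that is, $|\arg(p(z))|<\frac{\pi}{2}\mu$ for all $z\in\mathbb{U}$.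
   Context: $\mathbb{U}=\{z\in\mathbb{C}:|z|<1\}$ is the open unit disk. For $a_0\in\mathbb{C}$ and a positive integer $n$, $\mathcal{H}[a_0,n]$ is the class of functions $p$ analytic in $\mathbb{U}$ of the form $p(z)=a_0+\sum_{k=n}^{\infty}a_kz^k$. For real $0<\mu\leq 1$, $\mathcal{STH}[a_0,n](\mu)$ is the class of $p\in\mathcal{H}[a_0,n]$ with $|\arg(p(z))|<\frac{\pi}{2}\mu$ for all $z\in\mathbb{U}$. Here $\arg$ denotes the principal argument, with values in $(-\pi,\pi]$; a condition on $\arg(w)$ includes that $w\neq0$. *)

(* Defs.v *)
From Stdlib Require Import Reals Lra.
From Coquelicot Require Import Coquelicot.

Open Scope R_scope.

Definition in_disk (z : C) : Prop := Cmod z < 1.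

(* Principal argument, with values in (-PI, PI]; see [Carg_spec]. The value at
   0 is meaningless, which is why conditions on the argument are stated through
   [abs_arg_lt]. *)
Definition Carg (w : C) : R :=
  if Rle_dec 0 (Im w) then acos (Re w / Cmod w) else - acos (Re w / Cmod w).

Lemma Carg_spec (w : C) (hw : w <> 0%C) :
  - PI < Carg w <= PI /\
  w = (Cmod w * cos (Carg w), Cmod w * sin (Carg w)).
Proof.
assert (hm : 0 < Cmod w) by now apply Cmod_gt_0.
assert (h2 : Cmod w * Cmod w = Re w * Re w + Im w * Im w).
{ unfold Cmod, Re, Im; rewrite sqrt_sqrt; [ring|].
  generalize (pow2_ge_0 (fst w)) (pow2_ge_0 (snd w)); lra. }
set (t := Re w / Cmod w).
assert (ht : Re w = Cmod w * t) by (unfold t; field; lra).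
assert (hI : Im w * Im w = (Cmod w * Cmod w) * (1 - t * t))
  by (rewrite ht in h2; lra).
assert (hst : 0 <= 1 - t * t).
{ apply Rmult_le_reg_l with (Cmod w * Cmod w); [nra|].
  rewrite Rmult_0_r, <- hI; nra. }
assert (hb : -1 <= t <= 1) by (split; nra).
assert (hs : Rabs (Im w) = Cmod w * sqrt (1 - t²)).
{ rewrite <- sqrt_Rsqr_abs; unfold Rsqr at 1; rewrite hI.
  rewrite sqrt_mult; [|nra|exact hst].
  now rewrite sqrt_square by lra. }
assert (hw' : w = (Re w, Im w)) by (destruct w; reflexivity).
assert (ha := acos_bound t).
unfold Carg; fold t; destruct (Rle_dec 0 (Im w)) as [h|h].
- rewrite Rabs_pos_eq in hs by exact h.
  split; [generalize PI_RGT_0; lra|].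
  rewrite cos_acos, sin_acos, <- ht, <- hs by exact hb; exact hw'.
- rewrite Rabs_left in hs by lra.
  split.
  + assert (hne : acos t <> PI).
    { intro e; assert (hc := cos_acos t hb); rewrite e, cos_PI in hc.
      rewrite <- hc in hI; nra. }
    generalize PI_RGT_0; lra.
  + rewrite cos_neg, sin_neg, cos_acos, sin_acos, <- ht by exact hb.
    replace (Cmod w * - sqrt (1 - t²)) with (Im w) by lra; exact hw'.
Qed.

Definition abs_arg_lt (w : C) (t : R) : Prop := w <> 0%C /\ Rabs (Carg w) < t.

(* Analyticity in the disk is complex differentiability at each of its points.
   Functions are total on [C], but only their values in the disk matter. *)
Definition class_H (a0 : C) (n : nat) (p : C -> C) : Prop :=
  (forall z : C, in_disk z -> @ex_derive C_AbsRing C_NormedModule p z) /\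
  exists a : nat -> C,
    a 0%nat = a0 /\
    (forall k : nat, (0 < k < n)%nat -> a k = 0%C) /\
    (forall z : C, in_disk z -> @is_pseries C_AbsRing C_NormedModule a z (p z)).

Definition class_STH (a0 : C) (n : nat) (mu : R) (p : C -> C) : Prop :=
  class_H a0 n p /\
  forall z : C, in_disk z -> abs_arg_lt (p z) (PI / 2 * mu).

Definition rho (n : nat) (a0 mu : R) : R :=
  INR n * mu / (2 * a0) *
  (Rpower ((1 + mu) / (1 - mu)) ((1 - mu) / 2) +
   Rpower ((1 - mu) / (1 + mu)) ((1 + mu) / 2)).

(* Main.v *)
Require Import Defs.
From Stdlib Require Import Reals Lra Lia ClassicalEpsilon.
From Coquelicot Require Import Coquelicot.

Open Scope R_scope.

(** Put [alpha = PI * mu / 2]. If [p] leaves the sector [|arg| < alpha], let [z0]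
    be a point of smallest modulus with [|arg (p z0)| = alpha]. The function
    [q = p^(1/mu)] has positive real part for [|z| < |z0|], so
    [omega = (q - q 0) / (q + q 0)] maps that disk into the unit disk, vanishes to
    order [n] at 0, and has modulus 1 at [z0]; by the maximum principle for
    [omega / z^n], [|omega|] grows radially at [z0] at least like [|z|^n].
    Translated back to [p], [z0 p'(z0) / p(z0) = i K] with
    [|K| >= n mu (t + 1/t) / 2], [t = (|p z0| / a0)^(1/mu)]; minimising
    [(t + 1/t) / t^mu] over [t] gives [|K| >= |p z0| rho(mu)], which puts
    [p(z0) - z0 p'(z0) / p(z0)] outside the sector allowed by the hypothesis.

    Complex logarithms are avoided by working with [X + i Y = log (p / a0) / mu]
    in real coordinates, in which
    [|omega|^2 = (cosh X - cos Y) / (cosh X + cos Y)]. The maximum principle is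
    applied to [|omega|^2 |z|^(-2m) exp (del |z|^2)] with [m < n] and [del > 0]:
    the slack in [m] makes this continuous at 0, and [del] makes its logarithm
    strictly subharmonic, so that an interior maximum is excluded by the second
    derivatives along 1 and i. *)

Local Notation cpow := (@pow_n C_Ring).
Local Notation ccontinuous := (continuous (T:=C_UniformSpace) (U:=R_UniformSpace)).

(** * Complex power series *)

(** The error is compared with [eps * Cmod h] instead of being divided by [h], so [h = 0] needs no
    exclusion and the bound composes directly with curves. *)
Definition cdiff (f : C -> C) (z l : C) : Prop :=
  forall eps, 0 < eps -> exists del, 0 < del /\
    forall h, Cmod h < del -> Cmod (f (z + h) - f z - h * l)%C <= eps * Cmod h.

(** Lets [C_derive p] in the argument hypothesis be replaced by the sum of the termwise derived
    series. *)
Lemma cdiff_C_derive (f : C -> C) (z l : C) : cdiff f z l -> C_derive f z = l.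
Proof.
intros H; apply is_C_derive_unique.
split; [apply is_linear_scal_l|].
intros x hx eps.
assert (hzx := @is_filter_lim_locally_unique C_AbsRing (AbsRing_NormedModule C_AbsRing) z x
    hx); subst x.
destruct (H eps (cond_pos eps)) as [del [hd Hd]].
exists (mkposreal del hd); intros y hy.
change (Cmod (y - z)%C < del) in hy.
change (Cmod ((f y - f z) - (y - z) * l)%C <= eps * Cmod (y - z)%C).
replace y with (z + (y - z))%C at 1 by ring.
now apply Hd.
Qed.

Definition cps_sum (a : nat -> C) (f : C -> C) : Prop :=
  forall z : C, in_disk z -> @is_pseries C_AbsRing C_NormedModule a z (f z).

Definition cps_derive (a : nat -> C) (k : nat) : C := (INR (S k) * a (S k))%C.

Lemma Cmod_RtoC_nonneg x : 0 <= x -> Cmod (RtoC x) = x.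
Proof. intros; rewrite Cmod_R; now apply Rabs_pos_eq. Qed.

Lemma Cmod_pow_n (z : C) k : Cmod (cpow z k) = Cmod z ^ k.
Proof.
induction k as [|k IH]; [apply Cmod_1|].
change (Cmod (z * cpow z k)%C = Cmod z * Cmod z ^ k).
now rewrite Cmod_mult, IH.
Qed.

(** Convergence at a real point [r < 1] bounds the terms [a k * r^k], which is all that
    [CV_radius_bounded] asks of the series of moduli. *)
Lemma cps_radius (a : nat -> C) (f : C -> C) : cps_sum a f ->
  Rbar_le 1 (CV_radius (fun k => Cmod (a k))).
Proof.
intros H.
assert (B : forall r, 0 < r < 1 -> Rbar_le r (CV_radius (fun k => Cmod (a k)))).
{ intros r hr. apply (proj1 (CV_radius_bounded (fun k => Cmod (a k)))).
  assert (hd : in_disk (RtoC r)).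
  { unfold in_disk; rewrite Cmod_RtoC_nonneg; lra. }
  assert (Hs := H _ hd).
  set (u := fun k => @scal C_AbsRing C_NormedModule (cpow (RtoC r) k) (a k)).
  destruct (@filterlim_bounded C_AbsRing C_NormedModule (sum_n u)) as [M HM].
  { exists (f (RtoC r)); exact Hs. }
  assert (HM' : forall k, Cmod (@sum_n C_AbelianGroup u k) <= M) by exact HM.
  assert (hM : 0 <= M) by (eapply Rle_trans; [apply Cmod_ge_0|exact (HM' 0%nat)]).
  (* A term of index at least 1 is the difference of two consecutive partial sums, each of modulus
     at most [M]. *)
  exists (M + M); intros k.
  rewrite Rabs_pos_eq by (apply Rmult_le_pos; [apply Cmod_ge_0|apply pow_le; lra]).
  replace (Cmod (a k) * r ^ k) with (Cmod (u k)).
  2:{ unfold u. change (Cmod (cpow (RtoC r) k * a k)%C = Cmod (a k) * r ^ k).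
      rewrite Cmod_mult, Cmod_pow_n, (Cmod_RtoC_nonneg r) by lra; ring. }
  destruct k as [|k].
  - specialize (HM' 0%nat). rewrite sum_O in HM'; lra.
  - assert (A := HM' k). assert (B := HM' (S k)). rewrite sum_Sn in B.
    change (Cmod (@sum_n C_AbelianGroup u k + u (S k))%C <= M) in B.
    replace (u (S k)) with ((@sum_n C_AbelianGroup u k + u (S k)) + - @sum_n C_AbelianGroup u
        k)%C by ring.
    eapply Rle_trans; [apply Cmod_triangle|]. rewrite Cmod_opp; lra. }
destruct (CV_radius (fun k => Cmod (a k))) as [R0| |] eqn:E; simpl; trivial.
- apply Rnot_lt_le; intro h.
  assert (h0 : 0 <= R0) by (assert (X := CV_radius_ge_0 (fun k => Cmod (a k))); rewrite E in X;
      exact X).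
  assert (X := B ((1 + R0) / 2)). simpl in X. lra.
- apply (B (1/2)); lra.
Qed.

(** Formal differentiation keeps the radius of convergence. The second series serves the existence
    of the derived sum, the third dominates the first-order Taylor remainder. *)
Lemma cps_abs_converges (a : nat -> C) (f : C -> C) (r : R) : cps_sum a f -> 0 <= r < 1 ->
  ex_series (fun k => Cmod (a k) * r ^ k) /\
  ex_series (fun k => INR (S k) * Cmod (a (S k)) * r ^ k) /\
  ex_series (fun k => INR (S k) * (INR (S (S k)) * Cmod (a (S (S k)))) * r ^ k).
Proof.
intros H hr.
assert (HR := cps_radius a f H).
assert (hlt : Rbar_lt (Rabs r) (CV_radius (fun k => Cmod (a k)))).
{ apply Rbar_lt_le_trans with 1; [|exact HR]. simpl; rewrite Rabs_pos_eq; lra. }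
repeat split.
- refine (ex_series_ext _ _ _ (CV_disk_inside _ r hlt)).
  intros k; apply Rabs_pos_eq, Rmult_le_pos; [apply Cmod_ge_0|now apply pow_le].
- rewrite <- CV_radius_derive in hlt.
  refine (ex_series_ext _ _ _ (CV_disk_inside _ r hlt)).
  intros k; unfold PS_derive; apply Rabs_pos_eq, Rmult_le_pos; [|now apply pow_le].
  apply Rmult_le_pos; [apply pos_INR|apply Cmod_ge_0].
- rewrite <- CV_radius_derive, <- CV_radius_derive in hlt.
  refine (ex_series_ext _ _ _ (CV_disk_inside _ r hlt)).
  intros k; unfold PS_derive; apply Rabs_pos_eq, Rmult_le_pos; [|now apply pow_le].
  repeat apply Rmult_le_pos; try apply pos_INR; apply Cmod_ge_0.
Qed.

Lemma cps_derive_sum (a : nat -> C) (f : C -> C) : cps_sum a f ->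
  exists g, cps_sum (cps_derive a) g.
Proof.
intros H.
assert (E : forall z, in_disk z -> ex_series (fun k => @scal C_AbsRing C_NormedModule (cpow z
    k) (cps_derive a k))).
{ intros z hz.
  destruct (cps_abs_converges a f (Cmod z) H) as [_ [E _]].
  { split; [apply Cmod_ge_0|exact hz]. }
  refine (@ex_series_le C_AbsRing C_CompleteNormedModule _ _ _ E).
  intros k. change (Cmod (cpow z k * (INR (S k) * a (S k)))%C <= INR (S k) * Cmod (a (S k)) *
      Cmod z ^ k).
  rewrite !Cmod_mult, Cmod_pow_n, (Cmod_RtoC_nonneg _ (pos_INR _)); lra. }
(* Choice needs a value at every [z]; outside the disk it is 0, and nothing is claimed there. *)
assert (Ch : forall z, exists l, in_disk z -> @is_pseries C_AbsRing C_NormedModule (cps_derive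
    a) z l).
{ intros z; destruct (Rlt_dec (Cmod z) 1) as [h|h].
  - destruct (E z h) as [l hl]; exists l; intros _; exact hl.
  - exists (RtoC 0); intros h'; now destruct h. }
exists (fun z => proj1_sig (constructive_indefinite_description _ (Ch z))); intros z.
exact (proj2_sig (constructive_indefinite_description _ (Ch z))).
Qed.

(** The first-order remainder [R_j] of [(z + h)^j] satisfies
    [R_(j+1) = (z + h) R_j + j h^2 z^(j-1)], so the induction adds up [1 + 2 + ... + (k + 1)]. *)
Lemma Cpow_taylor_bound (z h : C) (r : R) k : Cmod z <= r -> Cmod (z + h)%C <= r ->
  Cmod (cpow (z + h)%C (S (S k)) - cpow z (S (S k)) - h * (INR (S (S k)) * cpow z (S k)))%C
  <= Cmod h ^ 2 * (INR (S k) * INR (S (S k)) / 2 * r ^ k).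
Proof.
intros hz hzh.
assert (hr : 0 <= r) by (assert (X := Cmod_ge_0 z); lra).
assert (P : forall w j, cpow w (S j) = (w * cpow w j)%C) by reflexivity.
assert (P0 : forall w, cpow w 0 = RtoC 1) by reflexivity.
assert (PR : forall w j, (w * cpow w j = cpow w j * w)%C) by (intros; ring).
induction k as [|k IH].
- rewrite !P, !P0.
  replace (_ - _ - _)%C with (h * h)%C by (cbn [INR]; rewrite RtoC_plus; ring).
  rewrite Cmod_mult; cbn [INR]; simpl; lra.
- set (N := INR (S (S k))) in *.
  assert (hN : INR (S (S (S k))) = N + 1) by (rewrite (S_INR (S (S k))); reflexivity).
  assert (hN1 : INR (S k) = N - 1) by (unfold N; rewrite (S_INR (S k)); ring).
  rewrite hN. rewrite hN1 in IH.
  replace (cpow (z + h)%C (S (S (S k))) - cpow z (S (S (S k))) - h * (RtoC (N + 1) * cpow z (S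
      (S k))))%C
  with ((z + h) * (cpow (z + h)%C (S (S k)) - cpow z (S (S k)) - h * (N * cpow z (S k))) + h *
      h * (N * cpow z (S k)))%C.
  2:{ rewrite (P (z + h)%C (S (S k))), (P z (S (S k))), (P z (S k)), RtoC_plus; ring. }
  eapply Rle_trans; [apply Cmod_triangle|].
  rewrite !Cmod_mult.
  assert (hN0 : 0 <= N) by apply pos_INR.
  rewrite (Cmod_RtoC_nonneg N hN0), Cmod_pow_n.
  assert (A1 := Rmult_le_compat _ _ _ _ (Cmod_ge_0 _) (Cmod_ge_0 _) hzh IH).
  assert (A2 : Cmod z ^ S k <= r ^ S k) by (apply pow_incr; split; [apply Cmod_ge_0|lra]).
  assert (A3 : Cmod h * Cmod h * (N * Cmod z ^ S k) <= Cmod h * Cmod h * (N * r ^ S k)).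
  { apply Rmult_le_compat_l; [apply Rmult_le_pos; apply Cmod_ge_0|].
      now apply Rmult_le_compat_l. }
  eapply Rle_trans; [apply Rplus_le_compat; [exact A1|exact A3]|].
  simpl; right; field.
Qed.

Lemma is_series_bound (u : nat -> C) (v : nat -> R) (l : C) (s : R) :
  @is_series C_AbsRing C_NormedModule u l -> is_series v s -> (forall k, Cmod (u k) <= v k) ->
      Cmod l <= s.
Proof.
intros Hu Hv H.
apply (filterlim_le (F:=eventually) (fun n => norm (@sum_n C_NormedModule u n)) (fun n => sum_n
    v n) (norm (K:=C_AbsRing) (V:=C_NormedModule) l) s).
- exists 0%nat; intros n _. eapply Rle_trans; [apply norm_sum_n_m|].
  apply sum_n_m_le; exact H.
- eapply filterlim_comp; [exact Hu|apply filterlim_norm].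
- exact Hv.
Qed.

Lemma is_series_drop_1 {K : AbsRing} {V : NormedModule K} (u : nat -> V) (l : V) :
  is_series u l -> is_series (fun k => u (S k)) (plus l (opp (u 0%nat))).
Proof.
intros H; apply is_series_incr_1.
match goal with |- is_series _ ?t => replace t with l; [exact H|] end.
rewrite <- plus_assoc.
etransitivity; [symmetry; apply plus_zero_r|].
apply f_equal; symmetry; apply (@plus_opp_l (NormedModule.AbelianGroup K V)).
Qed.

(** Combining the three series term by term leaves the first-order remainders of the powers; by
    [Cpow_taylor_bound] the error is at most [M * Cmod h ^ 2]. *)
Lemma cps_cdiff (a : nat -> C) (f g : C -> C) :
  cps_sum a f -> cps_sum (cps_derive a) g -> forall z, in_disk z -> cdiff f z (g z).
Proof.
intros Hf Hg z hz. unfold in_disk in hz.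
assert (hz0 := Cmod_ge_0 z).
(* The midpoint between [Cmod z] and 1 bounds both [z] and [z + h] once
   [Cmod h < (1 - Cmod z) / 2]. *)
set (r := (1 + Cmod z) / 2).
assert (hr : 0 <= r < 1) by (unfold r; lra).
destruct (cps_abs_converges a f r Hf hr) as [_ [_ [M HM]]].
assert (key : forall h, Cmod h < (1 - Cmod z) / 2 -> Cmod (f (z + h) - f z - h * g z)%C <= Cmod
    h ^ 2 * M).
{ intros h hh.
  assert (hzh : Cmod (z + h)%C <= r).
  { eapply Rle_trans; [apply Cmod_triangle|]. unfold r; lra. }
  assert (S1 := Hf (z + h)%C ltac:(unfold in_disk; lra)).
  assert (S2 := Hf z hz). assert (S3 := Hg z hz).
  unfold is_pseries in S1, S2, S3.
  assert (D := is_series_minus _ _ _ _ S1 S2).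
  (* The constant terms cancel here and the linear ones in [D2]; the shift aligns the indices with
     those of the derived series. *)
  apply is_series_drop_1 in D.
  apply (is_series_scal (V:=C_NormedModule) h) in S3.
  assert (D2 := is_series_minus _ _ _ _ D S3).
  apply is_series_drop_1 in D2.
  apply (is_series_scal (V:=R_NormedModule) (Cmod h ^ 2)) in HM.
  eapply (is_series_bound _ _ _ _) in D2; [|exact HM|].
  - eapply Rle_trans; [|exact D2]. right; apply f_equal.
    change (f (z + h) - f z - h * g z =
      (f (z + h) - f z + - (1 * a 0%nat - 1 * a 0%nat) - h * g z)
      + - ((cpow (z+h)%C 1 * a 1%nat - cpow z 1 * a 1%nat) - h * (1 * (INR 1 * a 1%nat))))%C.
    change (cpow (z+h)%C 1) with ((z+h)*1)%C.
    change (cpow z 1) with (z*1)%C. simpl INR. ring.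
  - intros k.
    change (Cmod ((cpow (z+h)%C (S (S k)) * a (S (S k)) - cpow z (S (S k)) * a (S (S k)))
       - h * (cpow z (S k) * (INR (S (S k)) * a (S (S k)))))%C
     <= Cmod h ^ 2 * (INR (S k) * (INR (S (S k)) * Cmod (a (S (S k)))) * r ^ k)).
    replace (_ - _)%C with ((cpow (z + h)%C (S (S k)) - cpow z (S (S k)) - h * (INR (S (S k)) *
        cpow z (S k))) * a (S (S k)))%C by ring.
    rewrite Cmod_mult.
    assert (B := Cpow_taylor_bound z h r k ltac:(unfold r; lra) hzh).
    apply (Rmult_le_compat_r (Cmod (a (S (S k))))) in B; [|apply Cmod_ge_0].
    eapply Rle_trans; [exact B|].
    assert (Q : 0 <= Cmod h ^ 2 * (INR (S k) * INR (S (S k)) * r ^ k) * Cmod (a (S (S k)))).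
    { repeat apply Rmult_le_pos; try apply pos_INR; try apply Cmod_ge_0; try apply pow_le;
        try apply Cmod_ge_0; lra. }
    lra. }
assert (hM0 : 0 <= M).
{ assert (X := key (RtoC ((1 - Cmod z)/4))). rewrite Cmod_RtoC_nonneg in X by lra.
  specialize (X ltac:(lra)). eapply Rle_trans in X; [|apply Cmod_ge_0].
  apply Rmult_le_reg_l with (((1 - Cmod z) / 4) ^ 2); [apply pow_lt|]; lra. }
intros eps he.
exists (Rmin ((1 - Cmod z) / 2) (eps / (M + 1))); split.
{ apply Rmin_pos; [lra|]. apply Rdiv_lt_0_compat; lra. }
intros h hh.
assert (h1 := Rlt_le_trans _ _ _ hh (Rmin_l _ _)).
assert (h2 := Rlt_le_trans _ _ _ hh (Rmin_r _ _)).
eapply Rle_trans; [apply key; exact h1|].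
assert (hc := Cmod_ge_0 h).
assert (X : Cmod h * (M + 1) <= eps).
{ apply Rmult_le_reg_r with (/ (M + 1)); [apply Rinv_0_lt_compat; lra|].
  rewrite Rmult_assoc, Rinv_r, Rmult_1_r by lra. unfold Rdiv in h2; lra. }
simpl. nra.
Qed.

(** For [k >= n] and [Cmod z <= 1/2], [Cmod z ^ k <= (2 * Cmod z)^n * (1/2)^k], so the tail is at
    most [(2 * Cmod z)^n] times the sum of the moduli at 1/2. *)
Lemma cps_tail_bound (a : nat -> C) (f : C -> C) (n : nat) : (1 <= n)%nat -> cps_sum a f ->
  (forall k, (0 < k < n)%nat -> a k = 0%C) ->
  exists M, 0 <= M /\ forall z, Cmod z <= 1/2 -> Cmod (f z - a 0%nat)%C <= M * Cmod z ^ n.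
Proof.
intros hn Hf Ha.
destruct (cps_abs_converges a f (1/2) Hf ltac:(lra)) as [[M HM] _].
assert (hM : 0 <= M).
{ rewrite <- (is_series_unique _ _ HM). rewrite <- (Rmult_0_l (Series (fun _ => 0))).
  rewrite <- Series_scal_l.
  apply Series_le; [|now exists M]. intros k; split; [lra|].
  rewrite Rmult_0_l. apply Rmult_le_pos; [apply Cmod_ge_0|apply pow_le; lra]. }
exists (2 ^ n * M); split; [apply Rmult_le_pos; [apply pow_le; lra|exact hM]|].
intros z hz.
assert (S1 := Hf z ltac:(unfold in_disk; lra)).
assert (hz0 := Cmod_ge_0 z).
unfold is_pseries in S1. apply is_series_drop_1 in S1.
apply (is_series_scal (V:=R_NormedModule) (2 ^ n * Cmod z ^ n)) in HM.
assert (HM0 := is_series_drop_1 _ _ HM).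
eapply (is_series_bound _ _ _ _) in S1; [|exact HM0|].
- replace (f z - a 0%nat)%C with (f z + - (1 * a 0%nat))%C by ring.
  eapply Rle_trans; [exact S1|].
  change (2 ^ n * Cmod z ^ n * M + - (2 ^ n * Cmod z ^ n * (Cmod (a 0%nat) * 1)) <= 2 ^ n * M *
      Cmod z ^ n).
  assert (0 <= 2 ^ n * Cmod z ^ n * (Cmod (a 0%nat) * 1)).
  { repeat apply Rmult_le_pos; try (apply pow_le; lra); try apply Cmod_ge_0; lra. }
  lra.
- intros k.
  change (Cmod (cpow z (S k) * a (S k))%C <= 2 ^ n * Cmod z ^ n * (Cmod (a (S k)) * (1/2) ^ (S
      k))).
  rewrite Cmod_mult, Cmod_pow_n.
  destruct (Nat.lt_ge_cases (S k) n) as [h|h].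
  + rewrite (Ha (S k)) by lia. rewrite Cmod_0; lra.
  + replace (S k) with (n + (S k - n))%nat at 1 4 by lia.
    rewrite !pow_add.
    assert (A : Cmod z ^ (S k - n) <= (1/2) ^ (S k - n)) by (apply pow_incr; lra).
    assert (B : 2 ^ n * (1/2) ^ n = 1) by (rewrite <- Rpow_mult_distr;
        replace (2 * (1/2)) with 1 by field; apply pow1).
    replace (2 ^ n * Cmod z ^ n * (Cmod (a (S k)) * ((1 / 2) ^ n * (1 / 2) ^ (S k - n))))
     with ((2 ^ n * (1/2) ^ n) * (Cmod z ^ n * Cmod (a (S k)) * (1 / 2) ^ (S k - n))) by ring.
    rewrite B.
    assert (0 <= Cmod z ^ n * Cmod (a (S k))) by (apply Rmult_le_pos;
        [now apply pow_le|apply Cmod_ge_0]).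
    nra.
Qed.

Lemma cps_value_0 (a : nat -> C) (f : C -> C) (n : nat) : (1 <= n)%nat -> cps_sum a f ->
  (forall k, (0 < k < n)%nat -> a k = 0%C) -> f 0%C = a 0%nat.
Proof.
intros hn Hf Ha. destruct (cps_tail_bound a f n hn Hf Ha) as [M [_ HM]].
specialize (HM 0%C). rewrite Cmod_0 in HM. rewrite pow_ne_zero in HM by lia.
assert (X := Cmod_ge_0 (f 0%C - a 0%nat)%C).
assert (Y : Cmod (f 0%C - a 0%nat)%C = 0) by lra.
apply Cmod_eq_0 in Y. replace (f 0%C) with (f 0%C - a 0%nat + a 0%nat)%C by ring.
rewrite Y; ring.
Qed.

(** * Compactness, curves and extrema *)

Lemma Cmod_le_sum_abs (z : C) : Cmod z <= Rabs (fst z) + Rabs (snd z).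
Proof.
replace z with (RtoC (fst z) + (0, snd z))%C at 1 by (destruct z; unfold RtoC, Cplus; simpl;
    f_equal; ring).
eapply Rle_trans; [apply Cmod_triangle|].
rewrite Cmod_R. apply Rplus_le_compat_l.
unfold Cmod; simpl. rewrite Rmult_0_l, Rplus_0_l, Rmult_1_r.
right; apply sqrt_Rsqr_abs.
Qed.

Lemma Cmod_ge_abs (z : C) : Rabs (fst z) <= Cmod z /\ Rabs (snd z) <= Cmod z.
Proof.
assert (H := Rmax_Cmod z). split; (eapply Rle_trans; [|exact H]); [apply Rmax_l|apply Rmax_r].
Qed.

Lemma Cmod_sqr (z : C) : Cmod z ^ 2 = fst z ^ 2 + snd z ^ 2.
Proof. unfold Cmod; apply pow2_sqrt. generalize (pow2_ge_0 (fst z)) (pow2_ge_0 (snd z)); lra.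
    Qed.

(** Without a maximum, every point would have a neighbourhood on which [atan f] stays a fixed amount
    below its supremum; compactness of a square makes the amount uniform, a contradiction. [atan]
    provides the boundedness from which the supremum exists. Semicontinuity suffices, which admits
    the jump function of [first_boundary_point]. *)
Lemma usc_attains_max (f : C -> R) (r : R) : 0 <= r ->
  (forall z, Cmod z <= r -> forall c, f z < c ->
     exists d, 0 < d /\ forall w, Cmod w <= r -> Cmod (w - z)%C < d -> f w < c) ->
  exists z, Cmod z <= r /\ forall w, Cmod w <= r -> f w <= f z.
Proof.
intros hr usc. apply NNPP; intro no.
assert (up : forall z, Cmod z <= r -> exists w, Cmod w <= r /\ f z < f w).
{ intros z hz. apply NNPP; intro h. apply no. exists z; split; [exact hz|].
  intros w hw. apply Rnot_lt_le; intro h'. apply h; now exists w. }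
set (S := fun y => exists w, Cmod w <= r /\ y = atan (f w)).
destruct (completeness S) as [M [HM1 HM2]].
{ exists (PI / 2). intros y [w [_ ->]]. left; apply atan_bound. }
{ exists (atan (f 0%C)). exists (RtoC 0); split; [rewrite Cmod_0; exact hr|reflexivity]. }
assert (cover : forall q : R * R, exists d : posreal, forall w, Cmod w <= r ->
   Rabs (fst w - fst q) < d -> Rabs (snd w - snd q) < d -> atan (f w) <= M - d).
{ intros q. set (z := q : C).
  assert (near : forall w d, Rabs (fst w - fst q) < d -> Rabs (snd w - snd q) < d ->
      Cmod (w - z)%C < 2 * d).
  { intros w d h1 h2. eapply Rle_lt_trans; [apply Cmod_le_sum_abs|].
    unfold z; simpl. unfold Rminus in *. lra. }
  destruct (Rle_lt_dec (Cmod z) r) as [hz|hz].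
  (* Two successive improvements: [f z1] bounds [f] near [z], and [f z2 > f z1] leaves room below
     the supremum [M]. *)
  - destruct (up z hz) as [z1 [h1 h1']]. destruct (up z1 h1) as [z2 [h2 h2']].
    destruct (usc z hz (f z1) h1') as [d0 [hd0 Hd0]].
    assert (g := atan_increasing _ _ h2').
    assert (hd : 0 < Rmin (d0 / 2) (atan (f z2) - atan (f z1))) by (apply Rmin_pos; lra).
    exists (mkposreal _ hd). simpl. intros w hw a1 a2.
    assert (b := near w _ a1 a2).
    assert (k1 := Rmin_l (d0 / 2) (atan (f z2) - atan (f z1))).
    assert (k2 := Rmin_r (d0 / 2) (atan (f z2) - atan (f z1))).
    assert (fw := Hd0 w hw ltac:(lra)). apply atan_increasing in fw.
    assert (HM1' := HM1 (atan (f z2)) ltac:(now exists z2)). lra.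
  (* Around a centre outside the closed disk, the neighbourhood misses the disk and the claim is
     vacuous. *)
  - assert (hd : 0 < (Cmod z - r) / 2) by lra.
    exists (mkposreal _ hd). simpl. intros w hw a1 a2.
    assert (b := near w _ a1 a2).
    assert (t := Cmod_triangle w (- (w - z))%C).
    replace (w + - (w - z))%C with z in t by ring. rewrite Cmod_opp in t. lra. }
set (delta := fun q => proj1_sig (constructive_indefinite_description _ (cover q))).
assert (Hdelta := fun q => proj2_sig (constructive_indefinite_description _ (cover q))).
change (forall q w, Cmod w <= r -> Rabs (fst w - fst q) < delta q ->
  Rabs (snd w - snd q) < delta q -> atan (f w) <= M - delta q) in Hdelta.
destruct (compactness_value_2d (-r) r (-r) r (fun u v => delta (u, v))) as [d Hd].
assert (ub : is_upper_bound S (M - d)).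
{ intros y [w [hw ->]]. apply Rnot_lt_le; intro lt.
  destruct (Cmod_ge_abs w) as [w1 w2].
  apply (Hd (fst w) (snd w)).
  - apply Rabs_le_between; lra.
  - apply Rabs_le_between; lra.
  - intros [u [v [_ [_ [h1 [h2 h3]]]]]].
    assert (X := Hdelta (u, v) w hw h1 h2). simpl in X. lra. }
assert (X := HM2 _ ub). assert (Y := cond_pos d). lra.
Qed.

Lemma is_derive_bound (h : R -> R) (s l : R) : is_derive h s l ->
  forall eps, 0 < eps -> exists d, 0 < d /\
    forall t, Rabs (t - s) < d -> Rabs (h t - h s - l * (t - s)) <= eps * Rabs (t - s).
Proof.
intros [_ H] eps he.
destruct (H s (fun P HP => HP) (mkposreal eps he)) as [d Hd].
exists d; split; [apply cond_pos|]. intros t ht.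
assert (X := Hd t ht).
change (Rabs (h t - h s - (t - s) * l) <= eps * Rabs (t - s)) in X.
now rewrite (Rmult_comm l).
Qed.

Lemma bound_is_derive (h : R -> R) (s l : R) :
  (forall eps, 0 < eps -> exists d, 0 < d /\
    forall t, Rabs (t - s) < d -> Rabs (h t - h s - l * (t - s)) <= eps * Rabs (t - s)) ->
  is_derive h s l.
Proof.
intros H; split; [apply is_linear_scal_l|].
intros x hx eps.
assert (hsx := @is_filter_lim_locally_unique R_AbsRing R_NormedModule s x hx); subst x.
destruct (H eps (cond_pos eps)) as [d [hd Hd]].
exists (mkposreal d hd); intros t ht.
change (Rabs (h t - h s - (t - s) * l) <= eps * Rabs (t - s)).
rewrite (Rmult_comm _ l); now apply Hd.
Qed.

(** The error [e] of the linear approximation has derivative 0 along the curve, and what remains is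
    affine in [c1] and [c2]. Multiplication by [l] in real coordinates carries the Cauchy-Riemann
    equations. *)
Lemma cdiff_curve (f : C -> C) (c1 c2 : R -> R) (s d1 d2 : R) (l : C) :
  is_derive c1 s d1 -> is_derive c2 s d2 -> cdiff f (c1 s, c2 s) l ->
  is_derive (fun t => fst (f (c1 t, c2 t))) s (d1 * fst l - d2 * snd l) /\
  is_derive (fun t => snd (f (c1 t, c2 t))) s (d1 * snd l + d2 * fst l).
Proof.
intros H1 H2 Hf.
set (z := (c1 s, c2 s) : C).
set (e := fun t => (f (c1 t, c2 t) - f z - ((c1 t, c2 t) - z) * l)%C).
assert (He : forall eps, 0 < eps -> exists d, 0 < d /\ forall t, Rabs (t - s) < d ->
    Cmod (e t) <= eps * Rabs (t - s)).
{ intros eps he.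
  (* A Lipschitz constant of the curve at [s]: near [s] the difference quotients are within 1 of
     [d1] and [d2]. *)
  set (L := Rabs d1 + Rabs d2 + 2).
  assert (hL : 0 < L) by (unfold L; generalize (Rabs_pos d1) (Rabs_pos d2); lra).
  destruct (Hf (eps / L) ltac:(apply Rdiv_lt_0_compat; lra)) as [del [hdel Hdel]].
  destruct (is_derive_bound _ _ _ H1 1 Rlt_0_1) as [e1 [he1 He1]].
  destruct (is_derive_bound _ _ _ H2 1 Rlt_0_1) as [e2 [he2 He2]].
  exists (Rmin (Rmin e1 e2) (del / L)); split.
  { repeat apply Rmin_pos; try lra. apply Rdiv_lt_0_compat; lra. }
  intros t ht.
  assert (k := Rlt_le_trans _ _ _ ht (Rmin_l _ _)).
  assert (k3 := Rlt_le_trans _ _ _ ht (Rmin_r _ _)).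
  assert (k1 := He1 t (Rlt_le_trans _ _ _ k (Rmin_l _ _))).
  assert (k2 := He2 t (Rlt_le_trans _ _ _ k (Rmin_r _ _))).
  set (T := Rabs (t - s)) in *. assert (hT : 0 <= T) by apply Rabs_pos.
  assert (m1 : Rabs (c1 t - c1 s) <= (Rabs d1 + 1) * T).
  { replace (c1 t - c1 s) with ((c1 t - c1 s - d1 * (t - s)) + d1 * (t - s)) by ring.
    eapply Rle_trans; [apply Rabs_triang|]. rewrite (Rabs_mult d1). fold T. lra. }
  assert (m2 : Rabs (c2 t - c2 s) <= (Rabs d2 + 1) * T).
  { replace (c2 t - c2 s) with ((c2 t - c2 s - d2 * (t - s)) + d2 * (t - s)) by ring.
    eapply Rle_trans; [apply Rabs_triang|]. rewrite (Rabs_mult d2). fold T. lra. }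
  assert (m : Cmod ((c1 t, c2 t) - z)%C <= L * T).
  { eapply Rle_trans; [apply Cmod_le_sum_abs|]. unfold z; simpl. unfold Rminus in *. unfold L.
      lra. }
  assert (X := Hdel ((c1 t, c2 t) - z)%C).
  fold z in X.
  assert (Q : (z + ((c1 t, c2 t) - z))%C = (c1 t, c2 t)) by (unfold Cplus, Cminus, Copp; simpl;
      f_equal; ring).
  rewrite Q in X.
  unfold e. eapply Rle_trans; [apply X|].
  - eapply Rle_lt_trans; [exact m|].
    apply (Rmult_lt_compat_l L) in k3; [|exact hL].
    replace (L * (del / L)) with del in k3 by (field; lra). exact k3.
  - apply Rle_trans with (eps / L * (L * T)).
    + apply Rmult_le_compat_l; [|exact m]. left; apply Rdiv_lt_0_compat; lra.
    + right; field; lra. }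
assert (es : e s = 0%C) by (unfold e; fold z; ring).
assert (D1 : is_derive (fun t => fst (e t)) s 0).
{ apply bound_is_derive; intros eps he. destruct (He eps he) as [d [hd Hd]].
  exists d; split; [exact hd|]; intros t ht. rewrite es.
  eapply Rle_trans; [|apply Hd; exact ht].
  replace (fst (e t) - fst (RtoC 0) - 0 * (t - s)) with (fst (e t)) by (simpl; ring).
      apply Cmod_ge_abs. }
assert (D2 : is_derive (fun t => snd (e t)) s 0).
{ apply bound_is_derive; intros eps he. destruct (He eps he) as [d [hd Hd]].
  exists d; split; [exact hd|]; intros t ht. rewrite es.
  eapply Rle_trans; [|apply Hd; exact ht].
  replace (snd (e t) - snd (RtoC 0) - 0 * (t - s)) with (snd (e t)) by (simpl; ring).
      apply Cmod_ge_abs. }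
assert (lin : forall (g : R -> R) k x y, is_derive g s 0 ->
  is_derive (fun t => g t + (k + ((c1 t - c1 s) * x + (c2 t - c2 s) * y))) s (d1 * x + d2 * y)).
{ intros g k x y Hg. auto_derive.
  - repeat split; try (eexists; eassumption).
  - rewrite (is_derive_unique (fun x : R => g x) _ _ Hg), (is_derive_unique (fun x : R => c1 x)
      _ _ H1), (is_derive_unique (fun x : R => c2 x) _ _ H2); ring. }
split.
- replace (d1 * fst l - d2 * snd l) with (d1 * fst l + d2 * - snd l) by ring.
  eapply is_derive_ext; [|apply (lin _ (fst (f z)) _ _ D1)].
  intros t; unfold e, z; simpl; ring.
- eapply is_derive_ext; [|apply (lin _ (snd (f z)) _ _ D2)].
  intros t; unfold e, z; simpl; ring.
Qed.

Lemma left_max_derive_nonneg (G : R -> R) (s l : R) : is_derive G s l ->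
  (exists d, 0 < d /\ forall t, s - d < t < s -> G t <= G s) -> 0 <= l.
Proof.
intros H [d [hd Hd]]. apply Rnot_lt_le; intro hl.
destruct (is_derive_bound _ _ _ H (- l / 2) ltac:(lra)) as [e [he He]].
set (u := Rmin d e / 2).
assert (hu : 0 < Rmin d e) by now apply Rmin_pos.
assert (u1 := Rmin_l d e). assert (u2 := Rmin_r d e).
assert (X := Hd (s - u) ltac:(unfold u; lra)).
assert (Y := He (s - u)). replace (s - u - s) with (- u) in Y by ring.
rewrite Rabs_Ropp, (Rabs_pos_eq u) in Y by (unfold u; lra).
specialize (Y ltac:(unfold u; lra)).
apply Rabs_le_between in Y.
assert (0 < u) by (unfold u; lra). nra.
Qed.

Lemma right_max_derive_nonpos (G : R -> R) (s l : R) : is_derive G s l ->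
  (exists d, 0 < d /\ forall t, s < t < s + d -> G t <= G s) -> l <= 0.
Proof.
intros H [d [hd Hd]].
assert (K : 0 <= - l).
{ apply (left_max_derive_nonneg (fun t => G (- t)) (- s)).
  - assert (H' : is_derive G (- - s) l) by (rewrite Ropp_involutive; exact H).
    auto_derive; [eexists; exact H'|]. rewrite (is_derive_unique (fun x : R => G x) _ _ H');
        ring.
  - exists d; split; [exact hd|]. intros t ht. rewrite Ropp_involutive. apply Hd; lra. }
lra.
Qed.

(** At the maximum [G1 0 = 0]; were [l] positive, [G1] would be positive just right of 0 and the
    mean value theorem would push [G] above [G 0]. *)
Lemma local_max_second_derive (G G1 : R -> R) (l : R) :
  (exists d, 0 < d /\ forall s, Rabs s < d -> is_derive G s (G1 s) /\ G s <= G 0) ->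
  is_derive G1 0 l -> l <= 0.
Proof.
intros [d [hd Hd]] H. apply Rnot_lt_le; intro hl.
assert (Z : G1 0 = 0).
{ assert (D0 := proj1 (Hd 0 ltac:(rewrite Rabs_R0; lra))).
  apply Rle_antisym.
  - apply (right_max_derive_nonpos G 0 _ D0). exists d; split; [exact hd|].
    intros t ht; apply Hd, Rabs_def1; lra.
  - apply (left_max_derive_nonneg G 0 _ D0). exists d; split; [exact hd|].
    intros t ht; apply Hd, Rabs_def1; lra. }
destruct (is_derive_bound _ _ _ H (l / 2) ltac:(lra)) as [e [he He]].
set (u := Rmin d e / 2).
assert (hu : 0 < Rmin d e) by now apply Rmin_pos.
assert (u1 := Rmin_l d e). assert (u2 := Rmin_r d e).
assert (hu' : 0 < u) by (unfold u; lra).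
destruct (MVT_cor2 G G1 0 u hu') as [c [Hc1 Hc2]].
{ intros c hc. apply is_derive_Reals, Hd, Rabs_def1; unfold u in *; lra. }
assert (Y := He c). rewrite Rminus_0_r, (Rabs_pos_eq c), Z in Y by lra.
specialize (Y ltac:(unfold u in *; lra)). apply Rabs_le_between in Y.
assert (X := proj2 (Hd u ltac:(rewrite Rabs_pos_eq; unfold u in *; lra))).
assert (0 < G1 c) by nra. nra.
Qed.

(** * The sector coordinates and the test function *)

(* [sectX + i sectY = log (w / a0) / mu] for [w] in the right half-plane. *)
Definition sectX (mu a0 : R) (w : C) : R := (ln (fst w ^ 2 + snd w ^ 2) / 2 - ln a0) / mu.
Definition sectY (mu : R) (w : C) : R := atan (snd w / fst w) / mu.

Lemma is_derive_sectX (mu a0 : R) (P1 P2 : R -> R) (s u1 u2 : R) : 0 < mu ->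
  0 < P1 s -> is_derive P1 s u1 -> is_derive P2 s u2 ->
  is_derive (fun t => sectX mu a0 (P1 t, P2 t)) s ((P1 s * u1 + P2 s * u2) / (P1 s ^ 2 + P2 s ^
      2) / mu).
Proof.
intros hmu h H1 H2. unfold sectX; simpl fst; simpl snd.
assert (0 < P1 s ^ 2 + P2 s ^ 2) by nra.
auto_derive.
- repeat split; try (eexists; eassumption). lra.
- rewrite (is_derive_unique (fun x : R => P1 x) _ _ H1), (is_derive_unique (fun x : R => P2 x)
    _ _ H2).
  field; split; nra.
Qed.

Lemma is_derive_sectY (mu : R) (P1 P2 : R -> R) (s u1 u2 : R) : 0 < mu ->
  0 < P1 s -> is_derive P1 s u1 -> is_derive P2 s u2 ->
  is_derive (fun t => sectY mu (P1 t, P2 t)) s ((u2 * P1 s - u1 * P2 s) / (P1 s ^ 2 + P2 s ^ 2)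
      / mu).
Proof.
intros hmu h H1 H2. unfold sectY; simpl fst; simpl snd.
auto_derive.
- repeat split; try (eexists; eassumption). lra.
- rewrite (is_derive_unique (fun x : R => P1 x) _ _ H1), (is_derive_unique (fun x : R => P2 x)
    _ _ H2).
  field; repeat split; try nra.
Qed.

(** With [Z = X + i Y] this is [ln (|tanh (Z / 2)|^2)], and [tanh (Z / 2)] is [omega] because
    [q / q 0 = exp Z]. *)
Definition lnquot (X Y : R) : R := ln (cosh X - cos Y) - ln (cosh X + cos Y).

Lemma cosh2_sinh2 x : cosh x ^ 2 = 1 + sinh x ^ 2.
Proof.
unfold cosh, sinh. assert (H : exp x * exp (- x) = 1) by (rewrite <- exp_plus, Rplus_opp_r;
    apply exp_0).
nra.
Qed.

Lemma cosh_ge_1 x : 1 <= cosh x.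
Proof.
unfold cosh. assert (H : exp x * exp (- x) = 1) by (rewrite <- exp_plus, Rplus_opp_r;
    apply exp_0).
assert (X := exp_pos x). assert (Y := exp_pos (- x)). 
assert (0 <= (exp x - exp (- x)) ^ 2) by apply pow2_ge_0. nra.
Qed.

(** [A] and [B] stand for the first derivatives of [X] and [Y] along a curve; in [ddlnquot], [A1]
    and [B1] stand for the second ones. *)
Definition dlnquot (X Y A B : R) : R :=
  2 * (sinh X * cos Y * A + sin Y * cosh X * B) / (cosh X ^ 2 - cos Y ^ 2).

Definition ddlnquot (X Y A B A1 B1 : R) : R :=
  (2 * ((cosh X * cos Y * A - sinh X * sin Y * B) * A + sinh X * cos Y * A1
        + (cos Y * cosh X * B + sin Y * sinh X * A) * B + sin Y * cosh X * B1)
     * (cosh X ^ 2 - cos Y ^ 2)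
   - 4 * (sinh X * cos Y * A + sin Y * cosh X * B) * (cosh X * sinh X * A + cos Y * sin Y * B))
  / (cosh X ^ 2 - cos Y ^ 2) ^ 2.

Lemma is_derive_lnquot (X Y : R -> R) (s A B : R) :
  is_derive X s A -> is_derive Y s B -> 0 < cosh (X s) - cos (Y s) ->
      0 < cosh (X s) + cos (Y s) ->
  is_derive (fun t => lnquot (X t) (Y t)) s (dlnquot (X s) (Y s) A B).
Proof.
intros HX HY h1 h2. unfold lnquot, dlnquot.
auto_derive.
- repeat split; try (eexists; eassumption); lra.
- rewrite (is_derive_unique (fun x : R => X x) _ _ HX), (is_derive_unique (fun x : R => Y x) _
    _ HY).
  field; repeat split; nra.
Qed.

Lemma is_derive_dlnquot (X Y A B : R -> R) (s A1 B1 : R) :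
  is_derive X s (A s) -> is_derive Y s (B s) -> is_derive A s A1 -> is_derive B s B1 ->
  0 < cosh (X s) - cos (Y s) -> 0 < cosh (X s) + cos (Y s) ->
  is_derive (fun t => dlnquot (X t) (Y t) (A t) (B t)) s (ddlnquot (X s) (Y s) (A s) (B s) A1
      B1).
Proof.
intros HX HY HA HB h1 h2. unfold ddlnquot, dlnquot.
auto_derive.
- repeat split; try (eexists; eassumption); nra.
- rewrite (is_derive_unique (fun x : R => X x) _ _ HX), (is_derive_unique (fun x : R => Y x) _
    _ HY),
    (is_derive_unique (fun x : R => A x) _ _ HA), (is_derive_unique (fun x : R => B x) _ _ HB).
  field; nra.
Qed.

(* The second argument list is the first one multiplied by i. *)
Lemma ddlnquot_harmonic (X Y A B A1 B1 : R) :
  0 < cosh X - cos Y -> 0 < cosh X + cos Y ->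
  ddlnquot X Y A B A1 B1 + ddlnquot X Y (- B) A (- A1) (- B1) = 0.
Proof.
intros h1 h2. unfold ddlnquot.
assert (E1 := cosh2_sinh2 X). assert (E2 := sin2_cos2 Y). unfold Rsqr in E2.
assert (hD : 0 < cosh X ^ 2 - cos Y ^ 2) by nra.
set (D := cosh X ^ 2 - cos Y ^ 2) in *.
(* The numerators add up to [4 cosh X cos Y (A^2 + B^2) (D - sinh^2 X - sin^2 Y)], so harmonicity
   rests on this form of [D]. *)
assert (HD : D = sinh X ^ 2 + sin Y ^ 2) by (unfold D; lra).
unfold Rdiv; rewrite <- Rmult_plus_distr_r.
match goal with |- ?t * _ = 0 => replace t with 0; [ring|] end.
clearbody D. subst D. ring.
Qed.

Lemma is_derive_dlog (mu : R) (P1 P2 u1 u2 : R -> R) (s p1 p2 v1 v2 : R) :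
  0 < mu -> 0 < P1 s -> is_derive P1 s p1 -> is_derive P2 s p2 -> is_derive u1 s v1 ->
      is_derive u2 s v2 ->
  is_derive (fun t => (P1 t * u1 t + P2 t * u2 t) / (P1 t ^ 2 + P2 t ^ 2) / mu) s
   (((p1 * u1 s + P1 s * v1 + p2 * u2 s + P2 s * v2) * (P1 s ^ 2 + P2 s ^ 2)
     - (P1 s * u1 s + P2 s * u2 s) * (2 * P1 s * p1 + 2 * P2 s * p2)) / (P1 s ^ 2 + P2 s ^ 2) ^
         2 / mu).
Proof.
intros hmu h H1 H2 H3 H4.
auto_derive.
- repeat split; try (eexists; eassumption); nra.
- rewrite (is_derive_unique (fun x : R => P1 x) _ _ H1), (is_derive_unique (fun x : R => P2 x)
    _ _ H2),
    (is_derive_unique (fun x : R => u1 x) _ _ H3), (is_derive_unique (fun x : R => u2 x) _ _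
        H4).
  field; split; nra.
Qed.

(** The logarithm of [|z|^(-2m) exp (del |z|^2)] at [z = x + i y], for [z] nonzero. *)
Definition weight (m del x y : R) : R := del * (x ^ 2 + y ^ 2) - m * ln (x ^ 2 + y ^ 2).

Lemma is_derive_weight (m del x y d1 d2 s : R) :
  0 < (x + s * d1) ^ 2 + (y + s * d2) ^ 2 ->
  is_derive (fun t => weight m del (x + t * d1) (y + t * d2)) s
   (2 * ((x + s * d1) * d1 + (y + s * d2) * d2) * (del - m / ((x + s * d1) ^ 2 + (y + s * d2) ^
       2))).
Proof.
intros h. unfold weight. auto_derive; [exact h|]. field. simpl in h; lra.
Qed.

Lemma is_derive_dweight (m del x y d1 d2 : R) :
  0 < x ^ 2 + y ^ 2 ->
  is_derive (fun s => 2 * ((x + s * d1) * d1 + (y + s * d2) * d2) * (del - m / ((x + s * d1) ^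
      2 + (y + s * d2) ^ 2))) 0
   (2 * (d1 ^ 2 + d2 ^ 2) * (del - m / (x ^ 2 + y ^ 2)) + 4 * m * (x * d1 + y * d2) ^ 2 / (x ^
       2 + y ^ 2) ^ 2).
Proof.
intros h. auto_derive.
- repeat split; trivial. rewrite !Rmult_0_l, !Rplus_0_r. simpl in h; lra.
- rewrite !Rmult_0_l, !Rplus_0_r. field. simpl in h; lra.
Qed.

Definition squot (X Y : R) : R := (cosh X - cos Y) / (cosh X + cos Y).

(** When [p 0 = a0], [squot] vanishes at the origin, so the value there is 0 whatever [weight] makes
    of [ln 0]. *)
Definition test (mu a0 m del : R) (p : C -> C) (z : C) : R :=
  squot (sectX mu a0 (p z)) (sectY mu (p z)) * exp (weight m del (fst z) (snd z)).

Lemma ln_test (mu a0 m del : R) (p : C -> C) (z : C) :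
  0 < cosh (sectX mu a0 (p z)) - cos (sectY mu (p z)) ->
  0 < cosh (sectX mu a0 (p z)) + cos (sectY mu (p z)) ->
  0 < test mu a0 m del p z /\
  ln (test mu a0 m del p z) = lnquot (sectX mu a0 (p z)) (sectY mu (p z)) + weight m del (fst
      z) (snd z).
Proof.
intros h1 h2. unfold test, squot, lnquot.
assert (q := Rdiv_lt_0_compat _ _ h1 h2).
split; [apply Rmult_lt_0_compat; [exact q|apply exp_pos]|].
rewrite ln_mult, ln_exp, ln_div; trivial. apply exp_pos.
Qed.

(* The real part of [u / (mu P)]; the imaginary part is obtained from
   [(u2, - u1)] in place of [(u1, u2)]. *)
Definition dlog (P1 P2 u1 u2 mu : R) : R := (P1 * u1 + P2 * u2) / (P1 ^ 2 + P2 ^ 2) / mu.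

(** The derivative of [dlog] when [P] moves with velocity [p] and [u] with velocity [v]. *)
Definition ddlog (P1 P2 p1 p2 u1 u2 v1 v2 mu : R) : R :=
  ((p1 * u1 + P1 * v1 + p2 * u2 + P2 * v2) * (P1 ^ 2 + P2 ^ 2)
     - (P1 * u1 + P2 * u2) * (2 * P1 * p1 + 2 * P2 * p2)) / (P1 ^ 2 + P2 ^ 2) ^ 2 / mu.

(** The derivative of the logarithm of [test] in the direction [d], with [D] in the role of p';
    [ddline] is the second derivative, with [E] in the role of p''. *)
Definition dline (mu a0 m del : R) (p D : C -> C) (z d : C) : R :=
  dlnquot (sectX mu a0 (p z)) (sectY mu (p z))
    (dlog (fst (p z)) (snd (p z)) (fst (d * D z)%C) (snd (d * D z)%C) mu)
    (dlog (fst (p z)) (snd (p z)) (snd (d * D z)%C) (- fst (d * D z)%C) mu)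
  + 2 * (fst z * fst d + snd z * snd d) * (del - m / (fst z ^ 2 + snd z ^ 2)).

Definition ddline (mu a0 m del : R) (p D E : C -> C) (z d : C) : R :=
  ddlnquot (sectX mu a0 (p z)) (sectY mu (p z))
    (dlog (fst (p z)) (snd (p z)) (fst (d * D z)%C) (snd (d * D z)%C) mu)
    (dlog (fst (p z)) (snd (p z)) (snd (d * D z)%C) (- fst (d * D z)%C) mu)
    (ddlog (fst (p z)) (snd (p z)) (fst (d * D z)%C) (snd (d * D z)%C)
       (fst (d * D z)%C) (snd (d * D z)%C) (fst (d * (d * E z))%C) (snd (d * (d * E z))%C) mu)
    (ddlog (fst (p z)) (snd (p z)) (fst (d * D z)%C) (snd (d * D z)%C)
       (snd (d * D z)%C) (- fst (d * D z)%C) (snd (d * (d * E z))%C) (- fst (d * (d * E z))%C)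
           mu)
  + (2 * (fst d ^ 2 + snd d ^ 2) * (del - m / (fst z ^ 2 + snd z ^ 2))
     + 4 * m * (fst z * fst d + snd z * snd d) ^ 2 / (fst z ^ 2 + snd z ^ 2) ^ 2).

Definition line (z d : C) (s : R) : C := (fst z + s * fst d, snd z + s * snd d).

Lemma line_0 (z d : C) : line z d 0 = z.
Proof. unfold line; destruct z; simpl; f_equal; ring. Qed.

Lemma is_derive_line (f : C -> C) (z d l : C) (s : R) : cdiff f (line z d s) l ->
  is_derive (fun t => fst (f (line z d t))) s (fst (d * l)%C) /\
  is_derive (fun t => snd (f (line z d t))) s (snd (d * l)%C).
Proof.
intros H. apply cdiff_curve; [| |exact H]; (auto_derive; [trivial|ring]).
Qed.

Lemma is_derive_sect_line (mu a0 : R) (p : C -> C) (z d l : C) (s : R) : 0 < mu ->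
  cdiff p (line z d s) l -> 0 < fst (p (line z d s)) ->
  is_derive (fun t => sectX mu a0 (p (line z d t))) s
    (dlog (fst (p (line z d s))) (snd (p (line z d s))) (fst (d * l)%C) (snd (d * l)%C) mu) /\
  is_derive (fun t => sectY mu (p (line z d t))) s
    (dlog (fst (p (line z d s))) (snd (p (line z d s))) (snd (d * l)%C) (- fst (d * l)%C) mu).
Proof.
intros hmu H h. destruct (is_derive_line _ _ _ _ _ H) as [H1 H2]. split.
- apply (is_derive_sectX mu a0 _ _ s _ _ hmu h H1 H2).
- replace (dlog _ _ (snd (d * l)%C) _ mu) with ((snd (d * l)%C * fst (p (line z d s)) - fst (d
    * l)%C * snd (p (line z d s))) / (fst (p (line z d s)) ^ 2 + snd (p (line z d s)) ^ 2) / mu)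
   by (unfold dlog; f_equal; f_equal; ring).
  apply (is_derive_sectY mu _ _ s _ _ hmu h H1 H2).
Qed.

Lemma is_derive_test_line (mu a0 m del : R) (p D : C -> C) (z d : C) (s : R) : 0 < mu ->
  let c := line z d s in
  cdiff p c (D c) -> 0 < fst (p c) -> 0 < fst c ^ 2 + snd c ^ 2 ->
  0 < cosh (sectX mu a0 (p c)) - cos (sectY mu (p c)) ->
  0 < cosh (sectX mu a0 (p c)) + cos (sectY mu (p c)) ->
  is_derive (fun t => lnquot (sectX mu a0 (p (line z d t))) (sectY mu (p (line z d t)))
     + weight m del (fst (line z d t)) (snd (line z d t))) s (dline mu a0 m del p D c d).
Proof.
intros hmu c H h hc h1 h2.
destruct (is_derive_sect_line mu a0 p z d _ s hmu H h) as [HX HY].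
assert (F := is_derive_lnquot _ _ s _ _ HX HY h1 h2).
assert (W := is_derive_weight m del (fst z) (snd z) (fst d) (snd d) s hc).
exact (is_derive_plus _ _ _ _ _ F W).
Qed.

(** Keeps a short segment away from the zeros of [omega], where [lnquot] is not smooth. *)
Lemma line_quot_pos_near (mu a0 : R) (p : C -> C) (z d l : C) : 0 < mu -> cdiff p z l ->
    0 < fst (p z) ->
  0 < cosh (sectX mu a0 (p z)) - cos (sectY mu (p z)) ->
  exists e, 0 < e /\ forall s, Rabs s < e ->
    0 < cosh (sectX mu a0 (p (line z d s))) - cos (sectY mu (p (line z d s))).
Proof.
intros hmu H hp hpos.
rewrite <- (line_0 z d) in H, hp.
destruct (is_derive_sect_line mu a0 p z d _ 0 hmu H hp) as [HX HY].
assert (C0 : continuous (fun t => cosh (sectX mu a0 (p (line z d t))) - cos (sectY mu (p (line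
    z d t)))) 0).
{ apply (ex_derive_continuous (V:=R_NormedModule)).
  assert (K : forall f g : R -> R, ex_derive f 0 -> ex_derive g 0 ->
      ex_derive (fun t => cosh (f t) - cos (g t)) 0).
  { intros f g Hf Hg. auto_derive. now repeat split. }
  apply (K (fun t => sectX mu a0 (p (line z d t))) (fun t => sectY mu (p (line z d t))));
      eexists; eassumption. }
destruct (C0 (fun y => 0 < y)) as [e He].
{ apply open_gt. rewrite line_0; exact hpos. }
exists e; split; [apply cond_pos|]. intros s hs. apply (He s).
change (Rabs (s - 0) < e). now rewrite Rminus_0_r.
Qed.

(** The logarithm of [test] inherits the maximum along a short segment, so the second derivative
    test applies to it; [0 <= cos] keeps the denominator [cosh + cos] positive. *)
Lemma interior_max_ddline (mu a0 m del rad : R) (p D E : C -> C) (z d : C) : 0 < mu ->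
    0 < rad ->
  (forall s, Rabs s < rad -> let c := line z d s in
     cdiff p c (D c) /\ cdiff D c (E c) /\ 0 < fst (p c) /\ 0 < fst c ^ 2 + snd c ^ 2 /\
     0 <= cos (sectY mu (p c)) /\ test mu a0 m del p c <= test mu a0 m del p z) ->
  0 < cosh (sectX mu a0 (p z)) - cos (sectY mu (p z)) ->
  ddline mu a0 m del p D E z d <= 0.
Proof.
intros hmu hrad H hpos.
assert (H0 := H 0 ltac:(rewrite Rabs_R0; lra)). cbv zeta in H0.
assert (plusp : forall w, 0 <= cos (sectY mu (p w)) -> 0 < cosh (sectX mu a0 (p w)) + cos
    (sectY mu (p w))).
{ intros w hw. assert (X := cosh_ge_1 (sectX mu a0 (p w))). lra. }
apply (local_max_second_derive
  (fun t => lnquot (sectX mu a0 (p (line z d t))) (sectY mu (p (line z d t)))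
     + weight m del (fst (line z d t)) (snd (line z d t)))
  (fun t => dline mu a0 m del p D (line z d t) d)).
- destruct H0 as [a1 [_ [a3 [_ [a5 _]]]]]. rewrite line_0 in a1, a3, a5.
  destruct (line_quot_pos_near mu a0 p z d _ hmu a1 a3 hpos) as [e [he He]].
  exists (Rmin rad e); split; [now apply Rmin_pos|].
  intros s hs.
  destruct (H s (Rlt_le_trans _ _ _ hs (Rmin_l _ _))) as [b1 [b2 [b3 [b4 [b5 b6]]]]].
  assert (b7 : 0 < cosh (sectX mu a0 (p (line z d s))) - cos (sectY mu (p (line z d s)))).
  { apply He. exact (Rlt_le_trans _ _ _ hs (Rmin_r _ _)). }
  split; [now apply is_derive_test_line; auto|].
  rewrite line_0.
  destruct (ln_test mu a0 m del p _ b7 (plusp _ b5)) as [t1 t2].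
  destruct (ln_test mu a0 m del p _ hpos (plusp _ a5)) as [t3 t4].
  rewrite <- t2, <- t4. now apply ln_le.
- destruct H0 as [a1 [a2 [a3 [a4 [a5 _]]]]].
  destruct (is_derive_sect_line mu a0 p z d _ 0 hmu a1 a3) as [HX HY].
  destruct (is_derive_line _ _ _ _ _ a1) as [P1 P2].
  destruct (is_derive_line _ _ _ _ _ a2) as [D1 D2].
  assert (U1 : is_derive (fun t => fst (d * D (line z d t))%C) 0 (fst (d * (d * E (line z d
      0)))%C)).
  { assert (T := is_derive_minus _ _ _ _ _ (is_derive_scal _ _ (fst d) _ D1) (is_derive_scal _
      _ (snd d) _ D2)).
    eapply is_derive_ext; [|exact T]. intros t; reflexivity. }
  assert (U2 : is_derive (fun t => snd (d * D (line z d t))%C) 0 (snd (d * (d * E (line z d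
      0)))%C)).
  { assert (T := is_derive_plus _ _ _ _ _ (is_derive_scal _ _ (fst d) _ D2) (is_derive_scal _ _
      (snd d) _ D1)).
    eapply is_derive_ext; [|exact T]. intros t; reflexivity. }
  assert (U3 := is_derive_opp _ _ _ U1).
  assert (A := is_derive_dlog mu _ _ _ _ 0 _ _ _ _ hmu a3 P1 P2 U1 U2).
  assert (B := is_derive_dlog mu _ _ _ _ 0 _ _ _ _ hmu a3 P1 P2 U2 U3).
  assert (W := is_derive_dweight m del (fst z) (snd z) (fst d) (snd d)).
  rewrite line_0 in a4. specialize (W a4).
  assert (h1 : 0 < cosh (sectX mu a0 (p (line z d 0))) - cos (sectY mu (p (line z d 0)))) by
      (rewrite line_0; exact hpos).
  assert (F := is_derive_dlnquot _ _ _ _ 0 _ _ HX HY A B h1 (plusp _ a5)).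
  assert (T := is_derive_plus _ _ _ _ _ F W).
  cbv beta in T. rewrite line_0 in T.
  exact T.
Qed.

(* All contributions to the Laplacian but that of [del |z|^2] are harmonic. *)
Lemma ddline_laplacian (mu a0 m del : R) (p D E : C -> C) (z : C) : 0 < mu ->
  0 < fst (p z) -> 0 < fst z ^ 2 + snd z ^ 2 ->
  0 < cosh (sectX mu a0 (p z)) - cos (sectY mu (p z)) ->
  0 < cosh (sectX mu a0 (p z)) + cos (sectY mu (p z)) ->
  ddline mu a0 m del p D E z (1, 0) + ddline mu a0 m del p D E z (0, 1) = 4 * del.
Proof.
intros hmu hp hz h1 h2. unfold ddline.
destruct (p z) as [p1 p2]; destruct (D z) as [u1 u2]; destruct (E z) as [v1 v2];
    destruct z as [x y].
simpl fst in *; simpl snd in *.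
assert (hN : p1 ^ 2 + p2 ^ 2 <> 0) by nra.
set (X := sectX mu a0 (p1, p2)) in *. set (Y := sectY mu (p1, p2)) in *.
set (A := dlog p1 p2 u1 u2 mu). set (B := dlog p1 p2 u2 (- u1) mu).
set (A1 := ddlog p1 p2 u1 u2 u1 u2 v1 v2 mu). set (B1 := ddlog p1 p2 u1 u2 u2 (- u1) v2 (- v1)
    mu).
(* [A + i B] is the derivative of [X + i Y] in direction 1. Direction i turns it into [- B + i A]
   and multiplies the second derivative by -1. *)
match goal with |- ddlnquot _ _ ?a ?b ?a1 ?b1 + ?w + (ddlnquot _ _ ?a' ?b' ?a1' ?b1' + ?w') = _
    =>
  replace a with A by (unfold A, dlog; field; lra);
  replace b with B by (unfold B, dlog; field; lra);
  replace a1 with A1 by (unfold A1, ddlog; field; lra);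
  replace b1 with B1 by (unfold B1, ddlog; field; lra);
  replace a' with (- B) by (unfold B, dlog; field; lra);
  replace b' with A by (unfold A, dlog; field; lra);
  replace a1' with (- A1) by (unfold A1, ddlog; field; lra);
  replace b1' with (- B1) by (unfold B1, ddlog; field; lra);
  transitivity ((ddlnquot X Y A B A1 B1 + ddlnquot X Y (- B) A (- A1) (- B1)) + (w + w'));
      [ring|]
end.
rewrite ddlnquot_harmonic by assumption. field. lra.
Qed.

(** * Continuity and quadratic estimates *)

Lemma cdiff_continuous (f : C -> C) (z l : C) : cdiff f z l ->
  forall eps, 0 < eps -> exists d, 0 < d /\ forall w, Cmod (w - z)%C < d ->
      Cmod (f w - f z)%C < eps.
Proof.
intros H eps he. destruct (H 1 Rlt_0_1) as [d [hd Hd]].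
set (L := Cmod l + 2). assert (hL : 0 < L) by (unfold L; generalize (Cmod_ge_0 l); lra).
exists (Rmin d (eps / L)); split.
{ apply Rmin_pos; [exact hd|]. now apply Rdiv_lt_0_compat. }
intros w hw.
assert (h1 := Rlt_le_trans _ _ _ hw (Rmin_l _ _)).
assert (h2 := Rlt_le_trans _ _ _ hw (Rmin_r _ _)).
assert (X := Hd _ h1). replace (z + (w - z))%C with w in X by ring.
replace (f w - f z)%C with ((f w - f z - (w - z) * l) + (w - z) * l)%C by ring.
eapply Rle_lt_trans; [apply Cmod_triangle|]. rewrite (Cmod_mult (w - z)).
apply (Rmult_lt_compat_l L) in h2; [|exact hL].
replace (L * (eps / L)) with eps in h2 by (field; lra).
assert (Y := Cmod_ge_0 (w - z)%C). unfold L in h2. nra.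
Qed.

(** A point of smallest modulus with [g <= 0] is the maximiser of an upper semicontinuous function.
    At smaller moduli [g] is positive, and radial approach gives [0 <= g] on the circle itself. *)
Lemma first_boundary_point (g : C -> R) (z1 : C) :
  (forall z, in_disk z -> forall eps, 0 < eps ->
     exists d, 0 < d /\ forall w, Cmod (w - z)%C < d -> Rabs (g w - g z) < eps) ->
  0 < g 0%C -> in_disk z1 -> g z1 <= 0 ->
  exists z0, 0 < Cmod z0 < 1 /\ g z0 = 0 /\ forall z, Cmod z <= Cmod z0 -> 0 <= g z.
Proof.
intros cont g0 hz1 gz1. unfold in_disk in *.
(* As -2 lies below every [- Cmod z] of the disk, a maximiser satisfies [g <= 0] and has the least
   modulus among such points. *)
set (f := fun z => if Rlt_dec 0 (g z) then -2 else - Cmod z).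
destruct (usc_attains_max f (Cmod z1) (Cmod_ge_0 z1)) as [z0 [hz0 Hz0]].
{ intros z hz c hc. destruct (Rlt_dec 0 (g z)) as [h|h].
  - destruct (cont z ltac:(lra) (g z) h) as [d [hd Hd]]. exists d; split; [exact hd|].
    intros w hw hwz. assert (X := Hd w hwz). apply Rabs_def2 in X.
    unfold f in *. destruct (Rlt_dec 0 (g z)); destruct (Rlt_dec 0 (g w)); lra.
  - exists (c + Cmod z). unfold f in hc. destruct (Rlt_dec 0 (g z)); [lra|].
    split; [lra|]. intros w hw hwz.
    assert (t := Cmod_triangle w (- (w - z))%C).
    replace (w + - (w - z))%C with z in t by ring. rewrite Cmod_opp in t.
    assert (t0 := Cmod_ge_0 z). unfold f; destruct (Rlt_dec 0 (g w)); lra. }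
assert (bad0 : g z0 <= 0).
{ assert (X := Hz0 z1 ltac:(lra)). unfold f in X.
  destruct (Rlt_dec 0 (g z1)); [lra|]. destruct (Rlt_dec 0 (g z0)); lra. }
assert (good : forall z, Cmod z < Cmod z0 -> 0 < g z).
{ intros z hz. assert (X := Hz0 z ltac:(lra)). unfold f in X.
  destruct (Rlt_dec 0 (g z)); [assumption|]. destruct (Rlt_dec 0 (g z0)); lra. }
assert (pos : 0 < Cmod z0).
{ destruct (Cmod_ge_0 z0) as [h|h]; [exact h|].
  symmetry in h. apply Cmod_eq_0 in h. rewrite h in bad0; lra. }
assert (nonneg : forall z, Cmod z <= Cmod z0 -> 0 <= g z).
{ intros z hz. apply Rnot_lt_le; intro neg.
  destruct (cont z ltac:(lra) (- g z) ltac:(lra)) as [d [hd Hd]].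
  (* The point [(1 - t) z] is within [d] of [z] and of modulus below [Cmod z0], so [g] would be both
     negative and positive there. *)
  set (t := Rmin d 1 / 2).
  assert (ht : 0 < Rmin d 1) by (apply Rmin_pos; lra).
  assert (ht1 := Rmin_l d 1). assert (ht2 := Rmin_r d 1).
  assert (z0pos := Cmod_ge_0 z).
  assert (X := Hd ((1 - t)%R * z)%C). replace ((1 - t)%R * z - z)%C with (- (t * z))%C in X by
      (rewrite RtoC_minus; ring).
  rewrite Cmod_opp, Cmod_mult, Cmod_RtoC_nonneg in X by (unfold t; lra).
  specialize (X ltac:(unfold t; nra)). apply Rabs_def2 in X.
  assert (Y := good ((1 - t)%R * z)%C). rewrite Cmod_mult, Cmod_RtoC_nonneg in Y by (unfold t;
      lra).
  specialize (Y ltac:(unfold t; nra)). lra. }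
exists z0; repeat split; [exact pos|lra| |exact nonneg].
apply Rle_antisym; [exact bad0|]. apply nonneg; lra.
Qed.

Lemma Rabs_atan_le x : Rabs (atan x) <= Rabs x.
Proof.
assert (P : forall y, 0 < y -> atan y <= y).
{ intros y hy.
  destruct (MVT_cor2 atan (fun t => / (1 + t ^ 2)) 0 y hy) as [c [E _]].
  { intros c _. apply is_derive_Reals. auto_derive; [trivial|field; nra]. }
  rewrite atan_0 in E.
  assert (/ (1 + c ^ 2) <= 1) by (rewrite <- Rinv_1; apply Rinv_le_contravar; nra). nra. }
destruct (Rtotal_order x 0) as [h|[h|h]].
- assert (X := P (- x) ltac:(lra)). rewrite atan_opp in X.
  assert (Y := atan_increasing _ _ h). rewrite atan_0 in Y.
  rewrite !Rabs_left by lra. lra.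
- rewrite h, atan_0; lra.
- assert (Y := atan_increasing _ _ h). rewrite atan_0 in Y.
  rewrite !Rabs_pos_eq by lra. now apply P.
Qed.

Lemma one_minus_cos_le y : 1 - cos y <= y ^ 2 / 2.
Proof.
replace y with (2 * (y / 2)) at 1 by field. rewrite cos_2a_sin.
assert (H : forall t, 0 <= t -> sin t ^ 2 <= t ^ 2).
{ intros t [ht|<-]; [|rewrite sin_0; lra].
  assert (X := sin_lt_x t ht). destruct (Rle_lt_dec (- t) (sin t)) as [h|h]; [nra|].
  destruct (Rle_lt_dec 1 t) as [h1|h1].
  - assert (Y := SIN_bound t). nra.
  - assert (Y := sin_gt_0 t ht ltac:(generalize PI2_1; lra)). nra. }
destruct (Rle_lt_dec 0 (y / 2)) as [h|h].
- assert (X := H _ h). nra.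
- assert (X := H (- (y / 2)) ltac:(lra)). rewrite sin_neg in X. nra.
Qed.

(** The inequality [exp y >= 1 + y] at [x] and [- x] yields [cosh x <= 1 / (1 - x^2)]; 4/3 is the
    slope of the chord of [1 / (1 - s)] over [0 <= s <= 1/4]. *)
Lemma cosh_minus_1_le x : x ^ 2 <= 1 / 4 -> cosh x - 1 <= 4 / 3 * x ^ 2.
Proof.
intros h. unfold cosh.
assert (hx : - (1 / 2) <= x <= 1 / 2) by nra.
assert (E : exp x * exp (- x) = 1) by (rewrite <- exp_plus, Rplus_opp_r; apply exp_0).
assert (A := exp_ineq1_le x). assert (B := exp_ineq1_le (- x)).
set (u := exp x) in *. set (v := exp (- x)) in *.
assert (u * (1 - x) <= 1) by nra. assert (v * (1 + x) <= 1) by nra.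
assert ((u + v) * (1 - x ^ 2) <= 2).
{ replace ((u + v) * (1 - x ^ 2)) with (u * (1 - x) * (1 + x) + v * (1 + x) * (1 - x)) by ring.
    nra. }
assert ((1 + 4 / 3 * x ^ 2) * (1 - x ^ 2) >= 1) by nra.
apply Rmult_le_reg_r with (1 - x ^ 2); nra.
Qed.

Lemma ln_Cmod (w : C) : w <> 0%C -> ln (fst w ^ 2 + snd w ^ 2) = 2 * ln (Cmod w).
Proof.
intros hw. rewrite <- Cmod_sqr, ln_pow by now apply Cmod_gt_0. simpl; ring.
Qed.

(** Both sector coordinates vanish at [a0] and are of the order of [w - a0] near it, while
    [cosh X - cos Y] is quadratic in them. *)
Lemma sect_quadratic_bound (mu a0 : R) (w : C) : 0 < mu < 1 -> 0 < a0 ->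
  Cmod (w - a0)%C <= a0 * mu / 4 ->
  cosh (sectX mu a0 w) - cos (sectY mu w) <= 2 * (2 / (a0 * mu)) ^ 2 * Cmod (w - a0)%C ^ 2.
Proof.
intros hmu ha he. set (e := Cmod (w - a0)%C) in *.
assert (he0 : 0 <= e) by apply Cmod_ge_0.
assert (heA : e <= a0 / 4) by nra.
destruct (Cmod_ge_abs (w - a0)%C) as [b1 b2]. fold e in b1, b2.
assert (b1' : Rabs (fst w - a0) <= e) by exact b1.
assert (b2' : Rabs (snd w) <= e).
{ replace (snd w) with (snd (w - a0)%C); [exact b2|]. simpl; ring. }
apply Rabs_le_between in b1'.
assert (t1 := Cmod_triangle (w - a0)%C a0). replace (w - a0 + a0)%C with w in t1 by ring.
assert (t2 := Cmod_triangle w (- (w - a0))%C). replace (w + - (w - a0))%C with (RtoC a0) in t2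
    by ring.
rewrite Cmod_opp in t2. rewrite (Cmod_RtoC_nonneg a0) in t1, t2 by lra. fold e in t1, t2.
(* A Lipschitz constant at [a0] for both coordinates; [k * e <= 1/2] puts [X] in the range of
   [cosh_minus_1_le]. *)
set (k := 2 / (a0 * mu)).
assert (hk : 0 < k) by (unfold k; apply Rdiv_lt_0_compat; nra).
assert (hke : k * e <= 1 / 2).
{ unfold k. apply Rmult_le_reg_l with (a0 * mu); [nra|].
  replace (a0 * mu * (2 / (a0 * mu) * e)) with (2 * e) by (field; split; lra). lra. }
assert (X : (sectX mu a0 w) ^ 2 <= (k * e) ^ 2).
{ unfold sectX. rewrite ln_Cmod by (apply Cmod_gt_0; lra).
  set (tau := Cmod w / a0).
  assert (htau : 3 / 4 <= tau).
  { unfold tau. apply Rmult_le_reg_r with a0; [lra|]. unfold Rdiv at 2. rewrite Rmult_assoc,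
      Rinv_l; lra. }
  replace (2 * ln (Cmod w) / 2 - ln a0) with (ln tau) by (unfold tau; rewrite ln_div; lra).
  assert (hte : Rabs (tau - 1) <= e / a0).
  { replace (tau - 1) with ((Cmod w - a0) / a0) by (unfold tau; field; lra).
    unfold Rdiv. rewrite Rabs_mult, (Rabs_pos_eq (/ a0)) by (left; apply Rinv_0_lt_compat; lra).
    apply Rmult_le_compat_r; [left; apply Rinv_0_lt_compat; lra|].
    apply Rabs_le_between; lra. }
  apply Rabs_le_between in hte.
  assert (l1 : ln tau <= tau - 1).
  { assert (Q := exp_ineq1_le (ln tau)). rewrite exp_ln in Q; lra. }
  assert (l2 : - ln tau <= / tau - 1).
  { rewrite <- ln_Rinv by lra. assert (Q := exp_ineq1_le (ln (/ tau))).
    rewrite exp_ln in Q; [lra|]. apply Rinv_0_lt_compat; lra. }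
  assert (l3 : / tau - 1 <= 2 * (e / a0)).
  { apply Rmult_le_reg_r with tau; [lra|]. rewrite Rmult_minus_distr_r, Rinv_l by lra. nra. }
  assert (kk : k * e = 2 * (e / a0) / mu) by (unfold k; field; split; lra).
  rewrite kk. assert (- (2 * (e / a0)) <= ln tau <= 2 * (e / a0)) by lra.
  unfold Rdiv. rewrite !Rpow_mult_distr. 
  apply Rmult_le_compat_r; [apply pow2_ge_0|]. unfold Rdiv in *. nra. }
assert (Y : (sectY mu w) ^ 2 <= (k * e) ^ 2).
{ apply pow_maj_Rabs. unfold sectY. unfold Rdiv at 1. rewrite Rabs_mult.
  rewrite (Rabs_pos_eq (/ mu)) by (left; apply Rinv_0_lt_compat; lra).
  replace (k * e) with (2 * e / a0 * / mu) by (unfold k; field; split; lra).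
  apply Rmult_le_compat_r; [left; apply Rinv_0_lt_compat; lra|].
  eapply Rle_trans; [apply Rabs_atan_le|]. unfold Rdiv at 1. rewrite Rabs_mult.
  rewrite (Rabs_pos_eq (/ fst w)) by (left; apply Rinv_0_lt_compat; lra).
  apply Rmult_le_reg_r with (fst w * a0); [nra|].
  replace (Rabs (snd w) * / fst w * (fst w * a0)) with (Rabs (snd w) * a0) by (field; lra).
  replace (2 * e / a0 * (fst w * a0)) with (2 * e * fst w) by (field; lra).
  assert (0 <= Rabs (snd w)) by apply Rabs_pos. nra. }
(* The two estimates add up to [(4/3 + 1/2) (k e)^2], below [2 (k e)^2]. *)
assert (A := cosh_minus_1_le (sectX mu a0 w) ltac:(assert (0 <= k * e) by nra; nra)).
assert (B := one_minus_cos_le (sectY mu w)).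
rewrite Rpow_mult_distr in X, Y.
assert (0 <= k ^ 2 * e ^ 2) by (apply Rmult_le_pos; apply pow2_ge_0). lra.
Qed.

Lemma continuous_comp_ex_derive (h : R -> R) (f : C -> R) (z : C) :
  ccontinuous f z -> ex_derive h (f z) ->
  ccontinuous (fun w => h (f w)) z.
Proof.
intros Hf Hh. apply (continuous_comp f h); [exact Hf|].
now apply (ex_derive_continuous (V:=R_NormedModule)).
Qed.

Lemma cdiff_continuous_parts (f : C -> C) (z l : C) : cdiff f z l ->
  ccontinuous (fun w => fst (f w)) z /\
  ccontinuous (fun w => snd (f w)) z.
Proof.
intros H.
assert (K : forall eps : posreal, exists d : posreal, forall w,
    ball (M:=C_UniformSpace) z d w -> Cmod (f w - f z)%C < eps).
{ intros eps. destruct (cdiff_continuous f z l H eps (cond_pos eps)) as [d [hd Hd]].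
  assert (hd2 : 0 < d / 2) by lra. exists (mkposreal _ hd2). intros w [h1 h2]. apply Hd.
  change (Rabs (fst w - fst z) < d / 2) in h1. change (Rabs (snd w - snd z) < d / 2) in h2.
  eapply Rle_lt_trans; [apply Cmod_le_sum_abs|]. simpl. unfold Rminus in *. lra. }
split; apply filterlim_locally; intros eps; destruct (K eps) as [d Hd]; exists d; intros w hw;
 (eapply Rle_lt_trans; [|exact (Hd w hw)]).
- change (Rabs (fst (f w - f z)%C) <= Cmod (f w - f z)%C). apply Cmod_ge_abs.
- change (Rabs (snd (f w - f z)%C) <= Cmod (f w - f z)%C). apply Cmod_ge_abs.
Qed.

Lemma test_continuous (mu a0 m del : R) (p : C -> C) (z l : C) : 0 < mu -> cdiff p z l ->
  0 < fst (p z) -> 0 < fst z ^ 2 + snd z ^ 2 -> 0 <= cos (sectY mu (p z)) ->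
  ccontinuous (test mu a0 m del p) z.
Proof.
intros hmu H hp hz hc.
destruct (cdiff_continuous_parts p z l H) as [C1 C2].
assert (N1 : ccontinuous (fun w : C => fst w) z) by apply continuous_fst.
assert (N2 : ccontinuous (fun w : C => snd w) z) by apply continuous_snd.
assert (SQ : forall f : C -> R, ccontinuous f z ->
   ccontinuous (fun w => f w ^ 2) z).
{ intros f Hf. apply (continuous_comp_ex_derive (fun x => x ^ 2)); [exact Hf|].
    now auto_derive. }
assert (CX : ccontinuous (fun w => sectX mu a0 (p w)) z).
{ apply (continuous_comp_ex_derive (fun x => (ln x / 2 - ln a0) / mu) (fun w => fst (p w) ^ 2 +
    snd (p w) ^ 2)).
  - apply (continuous_plus (V:=R_NormedModule)); now apply SQ.
  - auto_derive. nra. }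
assert (CY : ccontinuous (fun w => sectY mu (p w)) z).
{ apply (continuous_comp_ex_derive (fun x => atan x / mu) (fun w => snd (p w) / fst (p w))).
  - apply (continuous_mult (K:=R_AbsRing)); [exact C2|].
    apply (continuous_comp_ex_derive Rinv); [exact C1|]. auto_derive; lra.
  - now auto_derive. }
assert (CC : ccontinuous (fun w => cosh (sectX mu a0 (p w))) z).
{ apply (continuous_comp_ex_derive cosh); [exact CX|]. now auto_derive. }
assert (CD : ccontinuous (fun w => cos (sectY mu (p w))) z).
{ apply (continuous_comp_ex_derive cos); [exact CY|]. now auto_derive. }
assert (CN : ccontinuous (fun w : C => fst w ^ 2 + snd w ^ 2) z).
{ apply (continuous_plus (V:=R_NormedModule)); now apply SQ. }
unfold test. apply (continuous_mult (K:=R_AbsRing)).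
- apply (continuous_mult (K:=R_AbsRing)).
  + now apply (continuous_minus (V:=R_NormedModule)).
  + apply (continuous_comp_ex_derive Rinv (fun w => cosh (sectX mu a0 (p w)) + cos (sectY mu (p
      w)))).
    * now apply (continuous_plus (V:=R_NormedModule)).
    * auto_derive. assert (X := cosh_ge_1 (sectX mu a0 (p z))). lra.
- apply (continuous_comp_ex_derive (fun x => exp (del * x - m * ln x)) (fun w : C => fst w ^ 2
    + snd w ^ 2)); [exact CN|].
  auto_derive. simpl in hz; lra.
Qed.

(** * The boundary lemma *)

Lemma exp_monotone x y : x <= y -> exp x <= exp y.
Proof. intros [h| ->]; [left; now apply exp_increasing|lra]. Qed.

(** As [p - a0] is [O(|z|^n)], [squot] is [O(|z|^(2n))]; the weight costs [|z|^(-2m)], and the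
    remaining exponent [2 (n - m)] is positive. *)
Lemma test_small_at_0 (mu a0 m del M : R) (n : nat) (p : C -> C) : 0 < mu < 1 -> 0 < a0 ->
  0 < del -> m < INR n -> 0 <= M -> (1 <= n)%nat ->
  (forall z, Cmod z <= 1 / 2 -> Cmod (p z - a0)%C <= M * Cmod z ^ n) ->
  forall c, 0 < c -> exists d, 0 < d /\ forall z, 0 < Cmod z < d -> 0 <= cos (sectY mu (p z)) ->
    test mu a0 m del p z < c.
Proof.
intros hmu ha hdel hm hM hn HM c hc.
(* The constant in the bound [B |z|^(2 eps)] for [test], where [eps = n - m]. *)
set (B := 2 * (2 / (a0 * mu)) ^ 2 * (M + 1) ^ 2 * exp del).
assert (hB : 0 < B).
{ unfold B. assert (0 < 2 / (a0 * mu)) by (apply Rdiv_lt_0_compat; nra).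
  repeat apply Rmult_lt_0_compat; try lra; try apply exp_pos. }
set (eps := INR n - m). assert (heps : 0 < eps) by (unfold eps; lra).
(* [d1] brings [p z] within the reach of [sect_quadratic_bound], and [d2] solves
   [B * d2^(2 eps) = c]. *)
set (d1 := a0 * mu / 4 / (M + 1)).
assert (hd1 : 0 < d1) by (unfold d1; repeat apply Rdiv_lt_0_compat; nra).
set (d2 := exp (ln (c / B) / eps / 2)).
assert (hd2 : 0 < d2) by apply exp_pos.
exists (Rmin (1 / 2) (Rmin d1 d2)); split; [repeat apply Rmin_pos; lra|].
intros z [hz0 hz] hcos.
assert (k1 := Rlt_le_trans _ _ _ hz (Rmin_l _ _)).
assert (k2 := Rlt_le_trans _ _ _ hz (Rmin_r _ _)).
assert (k3 := Rlt_le_trans _ _ _ k2 (Rmin_l _ _)).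
assert (k4 := Rlt_le_trans _ _ _ k2 (Rmin_r _ _)).
assert (hp := HM z ltac:(lra)).
set (x := Cmod z) in *.
assert (hxn : 0 < x ^ n) by now apply pow_lt.
assert (hxn1 : x ^ n <= x).
{ destruct n as [|j]; [lia|]. simpl. assert (x ^ j <= 1 ^ j) by (apply pow_incr; lra).
    rewrite pow1 in *. nra. }
assert (hp1 : Cmod (p z - a0)%C <= a0 * mu / 4).
{ eapply Rle_trans; [exact hp|]. apply Rle_trans with ((M + 1) * d1); [nra|].
  unfold d1; right; field; lra. }
assert (Q := sect_quadratic_bound mu a0 (p z) hmu ha hp1).
assert (hp2 : Cmod (p z - a0)%C ^ 2 <= (M + 1) ^ 2 * (x ^ n) ^ 2).
{ rewrite <- Rpow_mult_distr. apply pow_incr; split; [apply Cmod_ge_0|nra]. }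
assert (N : fst z ^ 2 + snd z ^ 2 = x ^ 2) by (unfold x; now rewrite Cmod_sqr).
assert (hsq : squot (sectX mu a0 (p z)) (sectY mu (p z)) <= 2 * (2 / (a0 * mu)) ^ 2 * ((M + 1)
    ^ 2 * (x ^ n) ^ 2)).
{ unfold squot. assert (C1 := cosh_ge_1 (sectX mu a0 (p z))). assert (C2 :=
    COS_bound (sectY mu (p z))).
  apply Rle_trans with (cosh (sectX mu a0 (p z)) - cos (sectY mu (p z))).
  - apply Rmult_le_reg_r with (cosh (sectX mu a0 (p z)) + cos (sectY mu (p z))); [lra|].
    unfold Rdiv; rewrite Rmult_assoc, Rinv_l by lra. nra.
  - eapply Rle_trans; [exact Q|]. apply Rmult_le_compat_l; [|exact hp2].
    apply Rmult_le_pos; [lra|apply pow2_ge_0]. }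
unfold test, weight. rewrite N, ln_pow by exact hz0. simpl (INR 2).
eapply Rle_lt_trans; [apply Rmult_le_compat_r; [left; apply exp_pos|exact hsq]|].
assert (E1 : (x ^ n) ^ 2 = exp (2 * INR n * ln x)).
{ rewrite <- pow_mult, <- (exp_ln (x ^ (n * 2))) by now apply pow_lt.
  rewrite ln_pow, mult_INR by exact hz0. simpl (INR 2). f_equal; ring. }
apply Rle_lt_trans with (B * exp (2 * eps * ln x)).
- unfold B. rewrite E1.
  assert (E2 : exp (2 * INR n * ln x) * exp (del * x ^ 2 - m * ((1 + 1) * ln x)) <= exp del *
      exp (2 * eps * ln x)).
  { rewrite <- !exp_plus. apply exp_monotone. unfold eps.
    assert (del * x ^ 2 <= del) by (rewrite <- (Rmult_1_r del) at 2; apply Rmult_le_compat_l;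
        nra). lra. }
  assert (0 <= 2 * (2 / (a0 * mu)) ^ 2 * (M + 1) ^ 2).
  { apply Rmult_le_pos; [apply Rmult_le_pos; [lra|]|]; apply pow2_ge_0. }
  nra.
- assert (L : ln x < ln (c / B) / eps / 2).
  { rewrite <- (ln_exp (ln (c / B) / eps / 2)). now apply ln_increasing. }
  assert (L2 : 2 * eps * ln x < ln (c / B)).
  { apply (Rmult_lt_compat_l (2 * eps)) in L; [|lra].
    replace (2 * eps * (ln (c / B) / eps / 2)) with (ln (c / B)) in L by (field; lra). exact L.
        }
  apply exp_increasing in L2. rewrite exp_ln in L2 by (apply Rdiv_lt_0_compat; lra).
  apply (Rmult_lt_compat_l B) in L2; [|exact hB].
  replace (B * (c / B)) with c in L2 by (field; lra). exact L2.
Qed.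

Lemma Cmod_lt_add (z w : C) (r : R) : Cmod (w - z)%C < r -> Cmod z - r < Cmod w < Cmod z + r.
Proof.
intros h.
assert (t := Cmod_triangle w (- (w - z))%C). replace (w + - (w - z))%C with z in t by ring.
    rewrite Cmod_opp in t.
assert (t' := Cmod_triangle (w - z)%C z). replace (w - z + z)%C with w in t' by ring. lra.
Qed.

(* [test] is strictly log-subharmonic away from its zeros, and it vanishes at
   the origin because [m < n]. *)
Lemma test_max_on_circle (mu a0 m del M r : R) (n : nat) (p D E : C -> C) (z0 : C) :
  0 < mu < 1 -> 0 < a0 -> 0 < del -> m < INR n -> 0 <= M -> (1 <= n)%nat -> p 0%C = RtoC a0 ->
  (forall z, Cmod z <= 1 / 2 -> Cmod (p z - a0)%C <= M * Cmod z ^ n) ->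
  0 < r < 1 ->
  (forall z, Cmod z <= r -> cdiff p z (D z) /\ cdiff D z (E z) /\ 0 < fst (p z) /\ 0 <= cos
      (sectY mu (p z))) ->
  Cmod z0 = r -> cos (sectY mu (p z0)) = 0 ->
  forall z, Cmod z <= r -> test mu a0 m del p z <= test mu a0 m del p z0.
Proof.
intros hmu ha hdel hm hM hn hp0 HM hr Hp hz0 hY.
assert (Nz : forall z : C, fst z ^ 2 + snd z ^ 2 = Cmod z ^ 2) by (intros;
    now rewrite Cmod_sqr).
assert (T0 : test mu a0 m del p 0%C = 0).
{ unfold test, squot, sectX, sectY. rewrite hp0; simpl fst; simpl snd.
  replace (a0 ^ 2 + 0 ^ 2) with (a0 ^ 2) by ring. rewrite ln_pow by exact ha.
  replace ((INR 2 * ln a0 / 2 - ln a0) / mu) with 0 by (simpl; field; lra).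
  replace (atan (0 / a0) / mu) with 0.
  - rewrite cosh_0, cos_0. unfold Rdiv; ring.
  - unfold Rdiv at 2. rewrite Rmult_0_l, atan_0. unfold Rdiv; ring. }
(* On the boundary rays [|omega| = 1], so only the weight remains. *)
assert (TZ : test mu a0 m del p z0 = exp (weight m del (fst z0) (snd z0))).
{ unfold test, squot. rewrite hY. assert (X := cosh_ge_1 (sectX mu a0 (p z0))). field. lra. }
assert (TZpos : 0 < test mu a0 m del p z0) by (rewrite TZ; apply exp_pos).
destruct (usc_attains_max (test mu a0 m del p) r ltac:(lra)) as [zs [hzs Hzs]].
{ intros z hz c hc.
  destruct (Hp z hz) as [a1 [_ [a3 a4]]].
  destruct (Cmod_ge_0 z) as [h|h].
  - assert (hN : 0 < fst z ^ 2 + snd z ^ 2) by (rewrite Nz; nra).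
    assert (Cn := test_continuous mu a0 m del p z (D z) (proj1 hmu) a1 a3 hN a4).
    destruct (Cn (fun y => y < c)) as [d Hd]; [now apply open_lt|].
    exists d; split; [apply cond_pos|]. intros w _ hw. apply (Hd w).
    now apply C_NormedModule_mixin_compat1.
  - symmetry in h. apply Cmod_eq_0 in h. subst z. rewrite T0 in hc.
    destruct (test_small_at_0 mu a0 m del M n p hmu ha hdel hm hM hn HM c hc) as [d [hd Hd]].
    exists d; split; [exact hd|]. intros w hw hwd. replace (w - 0)%C with w in hwd by ring.
    destruct (Cmod_ge_0 w) as [h|h].
    + apply Hd; [lra|]. now apply Hp.
    + symmetry in h. apply Cmod_eq_0 in h. subst w. now rewrite T0. }
intros z hz. eapply Rle_trans; [apply Hzs; exact hz|].
destruct (Hp zs hzs) as [a1 [_ [a3 a4]]].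
assert (C1 := cosh_ge_1 (sectX mu a0 (p zs))).
(* Strictly inside, the second derivatives along 1 and i would both be nonpositive, with sum
   [4 del > 0]. On the circle the weight is the one at [z0], and [squot <= 1] because [0 <= cos]. *)
destruct hzs as [hlt|heq].
- exfalso.
  assert (Tpos : 0 < test mu a0 m del p zs) by (eapply Rlt_le_trans; [exact TZpos|apply Hzs;
      lra]).
  assert (zpos : 0 < Cmod zs).
  { destruct (Cmod_ge_0 zs) as [h|h]; [exact h|]. symmetry in h. apply Cmod_eq_0 in h.
      subst zs. lra. }
  assert (hpos : 0 < cosh (sectX mu a0 (p zs)) - cos (sectY mu (p zs))).
  { apply Rnot_le_lt; intro h. unfold test, squot in Tpos.
    assert (X := exp_pos (weight m del (fst zs) (snd zs))).
    assert ((cosh (sectX mu a0 (p zs)) - cos (sectY mu (p zs))) / (cosh (sectX mu a0 (p zs)) +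
        cos (sectY mu (p zs))) <= 0).
    { unfold Rdiv. assert (0 < / (cosh (sectX mu a0 (p zs)) + cos (sectY mu (p zs)))) by (apply
        Rinv_0_lt_compat; lra). nra. }
    nra. }
  (* Segments of this half-length around [zs] avoid 0 and stay inside the circle. *)
  set (rad := Rmin (Cmod zs) (r - Cmod zs)).
  assert (hrad : 0 < rad) by (apply Rmin_pos; lra).
  assert (r1 := Rmin_l (Cmod zs) (r - Cmod zs)). assert (r2 := Rmin_r (Cmod zs) (r - Cmod zs)).
      fold rad in r1, r2.
  assert (dir : forall d : C, Cmod d = 1 -> ddline mu a0 m del p D E zs d <= 0).
  { intros d hd. apply (interior_max_ddline mu a0 m del rad); [lra|exact hrad| |exact hpos].
    intros s hs c.
    assert (hc : Cmod (c - zs)%C < rad).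
    { replace (c - zs)%C with (s * d)%C by (unfold c, line; destruct zs, d; unfold Cminus,
        Cplus, Copp, Cmult, RtoC; simpl; f_equal; ring).
      rewrite Cmod_mult, hd, Cmod_R, Rmult_1_r. exact hs. }
    apply Cmod_lt_add in hc.
    destruct (Hp c ltac:(lra)) as [b1 [b2 [b3 b4]]].
    repeat split; trivial; [rewrite Nz; nra|apply Hzs; lra]. }
  assert (L := ddline_laplacian mu a0 m del p D E zs (proj1 hmu) a3 ltac:(rewrite Nz;
      nra) hpos ltac:(lra)).
  assert (d1 := dir (1, 0)). assert (d2 := dir (0, 1)).
  specialize (d1 Cmod_1).
  assert (m2 : Cmod (0, 1) = 1) by (unfold Cmod; simpl; replace (0 * (0 * 1) + 1 * (1 * 1))
      with 1 by ring; apply sqrt_1).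
  specialize (d2 m2). lra.
- rewrite TZ. unfold test.
  replace (weight m del (fst zs) (snd zs)) with (weight m del (fst z0) (snd z0)) by (unfold
      weight; rewrite !Nz, heq, hz0; reflexivity).
  rewrite <- (Rmult_1_l (exp _)) at 2. apply Rmult_le_compat_r; [left; apply exp_pos|].
  unfold squot. apply Rmult_le_reg_r with (cosh (sectX mu a0 (p zs)) + cos (sectY mu (p zs)));
      [lra|].
  unfold Rdiv; rewrite Rmult_assoc, Rinv_l by lra. lra.
Qed.

(** With [w = p z0] and [l = z0 p'(z0)], the conclusions say [l / w = i sg K] with
    [K >= n mu cosh X]. The first comes from the tangential derivative of [Y], extremal at [z0] on
    its circle; the second from the radial derivative of the logarithm of [test], nonnegative by
    [test_max_on_circle]. *)
Lemma jack_sector (mu a0 M sg : R) (n : nat) (p D E : C -> C) (z0 : C) :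
  0 < mu < 1 -> 0 < a0 -> 0 <= M -> (1 <= n)%nat -> p 0%C = RtoC a0 ->
  (forall z, Cmod z <= 1 / 2 -> Cmod (p z - a0)%C <= M * Cmod z ^ n) ->
  (forall z, in_disk z -> cdiff p z (D z) /\ cdiff D z (E z)) ->
  0 < Cmod z0 < 1 ->
  (forall z, Cmod z <= Cmod z0 -> 0 < fst (p z) /\ Rabs (sectY mu (p z)) <= PI / 2) ->
  sg = 1 \/ sg = -1 -> sectY mu (p z0) = sg * (PI / 2) ->
  fst (p z0) * fst (z0 * D z0)%C + snd (p z0) * snd (z0 * D z0)%C = 0 /\
  INR n * mu * cosh (sectX mu a0 (p z0)) * (fst (p z0) ^ 2 + snd (p z0) ^ 2)
   <= sg * (fst (p z0) * snd (z0 * D z0)%C - snd (p z0) * fst (z0 * D z0)%C).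
Proof.
intros hmu ha hM hn hp0 HM HD hz0 Hp hsg hY.
assert (PI0 := PI_RGT_0).
assert (hcos : cos (sectY mu (p z0)) = 0).
{ rewrite hY. destruct hsg as [-> | ->].
  - rewrite Rmult_1_l; apply cos_PI2.
  - replace (-1 * (PI / 2)) with (- (PI / 2)) by ring. rewrite cos_neg; apply cos_PI2. }
assert (hsin : sin (sectY mu (p z0)) = sg).
{ rewrite hY. destruct hsg as [-> | ->].
  - rewrite Rmult_1_l; apply sin_PI2.
  - replace (-1 * (PI / 2)) with (- (PI / 2)) by ring. rewrite sin_neg, sin_PI2; ring. }
destruct (Hp z0 ltac:(lra)) as [w1pos _].
assert (Npos : 0 < fst (p z0) ^ 2 + snd (p z0) ^ 2) by nra.
(* Differentiate [sg * Y] along the rotation [z0 exp (i t)], with coordinates [c1] and [c2]; it is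
   maximal at [t = 0]. *)
assert (tang : fst (p z0) * fst (z0 * D z0)%C + snd (p z0) * snd (z0 * D z0)%C = 0).
{ set (c1 := fun t => fst z0 * cos t - snd z0 * sin t). set (c2 :=
    fun t => fst z0 * sin t + snd z0 * cos t).
  assert (c0 : (c1 0, c2 0) = z0).
  { unfold c1, c2; rewrite cos_0, sin_0; destruct z0; simpl; f_equal; ring. }
  assert (cm : forall t, Cmod (c1 t, c2 t) = Cmod z0).
  { intros t. unfold Cmod. f_equal. simpl fst; simpl snd. unfold c1, c2.
    assert (X := sin2_cos2 t). unfold Rsqr in X. nra. }
  assert (d1 : is_derive c1 0 (- snd z0)).
  { unfold c1. auto_derive; [trivial|]. rewrite cos_0, sin_0; ring. }
  assert (d2 : is_derive c2 0 (fst z0)).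
  { unfold c2. auto_derive; [trivial|]. rewrite cos_0, sin_0; ring. }
  destruct (cdiff_curve p c1 c2 0 _ _ (D z0) d1 d2) as [e1 e2].
  { rewrite c0. apply HD; unfold in_disk; lra. }
  assert (pos0 : 0 < fst (p (c1 0, c2 0))) by now rewrite c0.
  assert (Y := is_derive_sectY mu _ _ 0 _ _ (proj1 hmu) pos0 e1 e2).
  assert (Ysg := is_derive_scal _ _ sg _ Y).
  set (dY := _ / mu) in Ysg. 
  assert (mx : forall t, sg * sectY mu (fst (p (c1 t, c2 t)), snd (p (c1 t,
      c2 t))) <= sg * sectY mu (fst (p (c1 0, c2 0)), snd (p (c1 0, c2 0)))).
  { intros t. rewrite c0. rewrite <- !surjective_pairing. rewrite hY.
    destruct (Hp (c1 t, c2 t) ltac:(rewrite cm; lra)) as [_ b]. apply Rabs_le_between in b.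
    destruct hsg as [-> | ->]; lra. }
  assert (z1 := left_max_derive_nonneg _ _ _ Ysg ltac:(exists 1; split; [lra|intros t _;
      apply mx])).
  assert (z2 := right_max_derive_nonpos _ _ _ Ysg ltac:(exists 1; split; [lra|intros t _;
      apply mx])).
  assert (z3 : dY = 0) by (destruct hsg as [-> | ->]; lra).
  unfold dY in z3. rewrite c0 in z3.
  apply (f_equal (fun x => x * mu * (fst (p z0) ^ 2 + snd (p z0) ^ 2))) in z3.
  rewrite !Rmult_0_l in z3. rewrite <- z3. simpl fst; simpl snd. field. split; [lra|].
  simpl in Npos; lra. }
split; [exact tang|].
set (Ch := cosh (sectX mu a0 (p z0))).
assert (hCh : 1 <= Ch) by apply cosh_ge_1.
set (K := sg * (fst (p z0) * snd (z0 * D z0)%C - snd (p z0) * fst (z0 * D z0)%C)).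
set (N := fst (p z0) ^ 2 + snd (p z0) ^ 2) in *.
(* Take [m = n - eps] and [del = eps]; since [|z0| < 1], the loss in the radial inequality is at
   most [2 eps]. *)
assert (approx : forall eps, 0 < eps -> (INR n - 2 * eps) * (mu * Ch * N) <= K).
{ intros eps heps.
  assert (mxz := test_max_on_circle mu a0 (INR n - eps) eps M (Cmod z0) n p D E z0 hmu ha heps
      ltac:(lra) hM hn hp0 HM hz0).
  specialize (mxz ltac:(intros z hz; destruct (HD z ltac:(unfold in_disk; lra)) as [q1 q2];
      destruct (Hp z hz) as [q3 q4];
    apply Rabs_le_between in q4; repeat split; trivial; apply cos_ge_0; lra) eq_refl hcos).
  assert (cd := proj1 (HD z0 ltac:(unfold in_disk; lra))).
  assert (hpos : 0 < cosh (sectX mu a0 (p z0)) - cos (sectY mu (p z0))) by (rewrite hcos;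
      fold Ch; lra).
  assert (hpos2 : 0 < cosh (sectX mu a0 (p z0)) + cos (sectY mu (p z0))) by (rewrite hcos;
      fold Ch; lra).
  destruct (line_quot_pos_near mu a0 p z0 z0 _ (proj1 hmu) cd w1pos hpos) as [e [he He]].
  assert (Nz : fst z0 ^ 2 + snd z0 ^ 2 = Cmod z0 ^ 2) by now rewrite Cmod_sqr.
  assert (der := is_derive_test_line mu a0 (INR n - eps) eps p D z0 z0 0 (proj1 hmu)).
  cbv zeta in der. rewrite !(line_0 z0 z0) in der.
  specialize (der cd w1pos ltac:(rewrite Nz; nra) hpos hpos2).
  apply left_max_derive_nonneg in der.
  2:{ exists (Rmin e 1); split; [apply Rmin_pos; lra|]. intros t ht.
    assert (k1 := Rmin_l e 1). assert (k2 := Rmin_r e 1).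
    assert (hl : Cmod (line z0 z0 t) <= Cmod z0).
    { replace (line z0 z0 t) with ((1 + t)%R * z0)%C by (unfold line; destruct z0;
        unfold Cmult, RtoC; simpl; f_equal; ring).
      rewrite Cmod_mult, Cmod_RtoC_nonneg by lra. nra. }
    assert (b7 := He t ltac:(apply Rabs_def1; lra)).
    destruct (Hp _ hl) as [b3 b4]. apply Rabs_le_between in b4.
    assert (b5 := cos_ge_0 (sectY mu (p (line z0 z0 t))) ltac:(lra) ltac:(lra)).
    assert (b6 := cosh_ge_1 (sectX mu a0 (p (line z0 z0 t)))).
    destruct (ln_test mu a0 (INR n - eps) eps p _ b7 ltac:(lra)) as [t1 t2].
    destruct (ln_test mu a0 (INR n - eps) eps p _ hpos hpos2) as [t3 t4].
    rewrite line_0. rewrite <- t2, <- t4. apply ln_le; [exact t1|]. now apply mxz. }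
  (* With [cos Y = 0] and [sin Y = sg], the contribution of [lnquot] reduces to
     [2 sg B / cosh X]. *)
  unfold dline, dlnquot in der. rewrite hcos, hsin in der. fold Ch in der.
  set (B := dlog (fst (p z0)) (snd (p z0)) (snd (z0 * D z0)%C) (- fst (z0 * D z0)%C) mu) in der.
  assert (hB : sg * B * (mu * N) = K).
  { unfold B, dlog, K. fold N. field. split; lra. }
  replace (fst z0 * fst z0 + snd z0 * snd z0) with (Cmod z0 ^ 2) in der by (rewrite <- Nz;
      ring).
  rewrite Nz in der.
  replace (2 * Cmod z0 ^ 2 * (eps - (INR n - eps) / Cmod z0 ^ 2)) with (2 * (eps * Cmod z0 ^ 2
      - (INR n - eps))) in der by (field; lra).
  match type of der with 0 <= ?q + _ => replace q with (2 * (sg * B / Ch)) in der by (field;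
      lra) end.
  assert (ez : eps * Cmod z0 ^ 2 <= eps) by (rewrite <- (Rmult_1_r eps) at 2;
      apply Rmult_le_compat_l; nra).
  assert (d3 : INR n - 2 * eps <= sg * B / Ch) by lra.
  apply (Rmult_le_compat_r (mu * Ch * N)) in d3; [|apply Rmult_le_pos; [apply Rmult_le_pos|];
      lra].
  replace (sg * B / Ch * (mu * Ch * N)) with (sg * B * (mu * N)) in d3 by (field; lra).
  rewrite hB in d3. exact d3. }
apply Rnot_lt_le; intro h.
set (Q := mu * Ch * N) in *.
assert (hQ : 0 < Q) by (unfold Q; apply Rmult_lt_0_compat; [apply Rmult_lt_0_compat|]; lra).
replace (INR n * mu * Ch * N) with (INR n * Q) in h by (unfold Q; ring).
(* This [eps] makes the loss [2 eps Q] half of the supposed gap [n Q - K]. *)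
assert (X := approx ((INR n * Q - K) / (4 * Q)) ltac:(apply Rdiv_lt_0_compat; lra)).
replace ((INR n - 2 * ((INR n * Q - K) / (4 * Q))) * Q) with (INR n * Q - (INR n * Q - K) / 2)
    in X by (field; lra).
lra.
Qed.

(** * The theorem *)

(* Tangent-line bounds for both exponentials at [ln ((1 + mu) / (1 - mu)) / 2],
   where the linear terms cancel. *)
Lemma rho_le (n : nat) (a0 mu X : R) : 0 < a0 -> 0 < mu < 1 ->
  rho n a0 mu <= INR n * mu / (2 * a0) * (exp ((1 - mu) * X) + exp (- ((1 + mu) * X))).
Proof.
intros ha hmu. unfold rho, Rpower.
apply Rmult_le_compat_l.
{ apply Rdiv_le_0_compat; [|lra]. apply Rmult_le_pos; [apply pos_INR|lra]. }
set (X0 := ln ((1 + mu) / (1 - mu)) / 2).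
assert (hb : 0 < (1 + mu) / (1 - mu)) by (apply Rdiv_lt_0_compat; lra).
replace (ln ((1 - mu) / (1 + mu))) with (- ln ((1 + mu) / (1 - mu))).
2:{ rewrite <- ln_Rinv by exact hb. f_equal. field; lra. }
replace ((1 - mu) / 2 * ln ((1 + mu) / (1 - mu))) with ((1 - mu) * X0) by (unfold X0; field).
replace ((1 + mu) / 2 * - ln ((1 + mu) / (1 - mu))) with (- ((1 + mu) * X0)) by (unfold X0;
    field).
(* The derivative of the sum of the two exponentials vanishes at [X0]. *)
assert (rel : (1 - mu) * exp ((1 - mu) * X0) = (1 + mu) * exp (- ((1 + mu) * X0))).
{ replace ((1 - mu) * X0) with (ln ((1 + mu) / (1 - mu)) + - ((1 + mu) * X0)) by (unfold X0;
    field).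
  rewrite exp_plus, exp_ln by exact hb. field; lra. }
assert (tan : forall u u0, exp u0 * (1 + (u - u0)) <= exp u).
{ intros u u0. replace u with (u0 + (u - u0)) at 2 by ring. rewrite exp_plus.
  apply Rmult_le_compat_l; [left; apply exp_pos|apply exp_ineq1_le]. }
assert (A := tan ((1 - mu) * X) ((1 - mu) * X0)).
assert (B := tan (- ((1 + mu) * X)) (- ((1 + mu) * X0))).
assert (C : exp ((1 - mu) * X0) * ((1 - mu) * X - (1 - mu) * X0) + exp (- ((1 + mu) * X0)) * (-
    ((1 + mu) * X) - - ((1 + mu) * X0)) = 0).
{ replace (exp ((1 - mu) * X0) * ((1 - mu) * X - (1 - mu) * X0)) with ((1 - mu) * exp ((1 - mu)
    * X0) * (X - X0)) by ring.
  rewrite rel. ring. }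
lra.
Qed.

(** The linear form equals [|w| sin (alpha - |arg w|)], which is nonpositive when
    [|arg w| >= alpha]. Membership in the sector thus becomes the sign of a continuous function of
    [w]. *)
Lemma sector_abs_arg_lt (w : C) (alpha : R) : 0 < alpha < PI / 2 -> w <> 0%C ->
  0 < sin alpha * fst w - cos alpha * Rabs (snd w) -> abs_arg_lt w alpha.
Proof.
intros ha hw h. split; [exact hw|].
destruct (Carg_spec w hw) as [b e]. set (c := Carg w) in *.
assert (hm : 0 < Cmod w) by now apply Cmod_gt_0.
apply Rnot_le_lt; intro hc.
assert (habs : Rabs c <= PI) by (apply Rabs_le_between; lra).
assert (s : 0 <= sin (Rabs c - alpha)) by (apply sin_ge_0; lra).
rewrite sin_minus in s.
assert (cc : cos (Rabs c) = cos c) by (unfold Rabs; destruct (Rcase_abs c);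
    [apply cos_neg|reflexivity]).
assert (ss : sin (Rabs c) <= Rabs (sin c)).
{ unfold Rabs at 1; destruct (Rcase_abs c); [rewrite sin_neg, <- Rabs_Ropp|]; apply Rle_abs. }
rewrite cc in s.
assert (ca : 0 < cos alpha) by (apply cos_gt_0; lra).
rewrite e in h; simpl fst in h; simpl snd in h.
rewrite Rabs_mult, (Rabs_pos_eq (Cmod w)) in h by lra.
assert (0 < Cmod w * (sin alpha * cos c - cos alpha * Rabs (sin c))) by lra.
assert (0 < sin alpha * cos c - cos alpha * Rabs (sin c)) by nra.
nra.
Qed.

(** The same identity in the other direction: [0 < t - |arg w| < pi / 2] has positive sine. *)
Lemma abs_arg_lt_sector (w : C) (t : R) : t < PI / 2 -> abs_arg_lt w t ->
  cos t * Rabs (snd w) < sin t * fst w.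
Proof.
intros ht [hw hc].
destruct (Carg_spec w hw) as [b e]. set (c := Carg w) in *.
assert (hm : 0 < Cmod w) by now apply Cmod_gt_0.
assert (c0 := Rabs_pos c).
assert (s : 0 < sin (t - Rabs c)) by (apply sin_gt_0; lra).
rewrite sin_minus in s.
assert (cc : cos (Rabs c) = cos c) by (unfold Rabs; destruct (Rcase_abs c);
    [apply cos_neg|reflexivity]).
assert (ss : Rabs (sin c) = sin (Rabs c)).
{ rewrite <- (Rabs_pos_eq (sin (Rabs c))) by (apply sin_ge_0; lra).
  unfold Rabs at 3; destruct (Rcase_abs c); [rewrite sin_neg, Rabs_Ropp|]; reflexivity. }
rewrite e; simpl fst; simpl snd. rewrite Rabs_mult, (Rabs_pos_eq (Cmod w)), ss by lra.
rewrite cc in s. nra.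
Qed.

(** [w] lies on the ray of argument [sg alpha], with modulus [fst w / cos alpha]. Moving it
    vertically by [|w| rh] gives argument [- sg (atan T - alpha)], exactly on the edge of the
    assumed sector, and a larger [ka] moves it further out. *)
Lemma boundary_value_excluded (w : C) (alpha rh ka sg : R) :
  0 < alpha < PI / 2 -> 0 < rh -> sg = 1 \/ sg = -1 -> 0 < fst w ->
  cos alpha * snd w = sg * (sin alpha * fst w) ->
  fst w / cos alpha * rh <= ka ->
  ~ abs_arg_lt (fst w, snd w - sg * ka) (atan (rh * cos alpha / (1 - rh * sin alpha)) - alpha).
Proof.
intros ha hr hsg hw heq hka H.
assert (ca : 0 < cos alpha) by (apply cos_gt_0; lra).
assert (sa : 0 < sin alpha) by (apply sin_gt_0; lra).
set (T := rh * cos alpha / (1 - rh * sin alpha)) in *.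
assert (tpos : 0 < atan T).
{ destruct H as [_ H]. assert (X := Rabs_pos (Carg (fst w, snd w - sg * ka))). lra. }
(* A nonpositive denominator would give [T <= 0] (a zero one gives [T = 0] by [Rinv_0]), but the
   assumed sector has positive opening. *)
assert (hq : 0 < 1 - rh * sin alpha).
{ apply Rnot_le_lt; intro h.
  assert (T <= 0).
  { unfold T, Rdiv. destruct h as [h|h].
    - assert (Z := Rinv_lt_0_compat _ h). assert (0 < rh * cos alpha) by nra. nra.
    - rewrite h, Rinv_0; lra. }
  destruct H0 as [h0|h0]; [apply atan_increasing in h0|rewrite h0 in tpos];
      rewrite atan_0 in *; lra. }
apply abs_arg_lt_sector in H; [|generalize (atan_bound T); lra].
simpl fst in H; simpl snd in H.
assert (cphi : 0 < cos (atan T)) by (apply cos_gt_0; generalize (atan_bound T); lra).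
assert (tphi : sin (atan T) = T * cos (atan T)).
{ transitivity (tan (atan T) * cos (atan T)); [unfold tan; field; lra|now rewrite tan_atan]. }
(* [la] scales the denominator and numerator of [T] to the cosine and sine of [atan T], whence [tan
   (atan T - alpha) = (rh - sin alpha) / cos alpha]. *)
set (la := cos (atan T) / (1 - rh * sin alpha)).
assert (hla : 0 < la) by now apply Rdiv_lt_0_compat.
assert (c1 : cos (atan T) = la * (1 - rh * sin alpha)) by (unfold la; field; lra).
assert (s1 : sin (atan T) = la * (rh * cos alpha)).
{ rewrite tphi. replace (rh * cos alpha) with (T * (1 - rh * sin alpha)) by (unfold T; field;
    lra).
  unfold la; field; lra. }
rewrite sin_minus, cos_minus, s1, c1 in H.
assert (P := sin2_cos2 alpha). unfold Rsqr in P.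
replace (la * (rh * cos alpha) * cos alpha - la * (1 - rh * sin alpha) * sin alpha) with (la *
    (rh * (sin alpha * sin alpha + cos alpha * cos alpha) - sin alpha)) in H by ring.
rewrite P, Rmult_1_r in H.
replace (la * (1 - rh * sin alpha) * cos alpha + la * (rh * cos alpha) * sin alpha) with (la *
    cos alpha) in H by ring.
assert (H2 : cos alpha * Rabs (snd w - sg * ka) < (rh - sin alpha) * fst w) by nra.
assert (H3 : ka - sg * snd w <= Rabs (snd w - sg * ka)).
{ destruct hsg as [-> | ->]; [rewrite <- Rabs_Ropp|]; (eapply Rle_trans; [|apply Rle_abs]);
    lra. }
assert (H4 : cos alpha * (sg * snd w) = sin alpha * fst w).
{ replace (cos alpha * (sg * snd w)) with (sg * (cos alpha * snd w)) by ring. rewrite heq.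
    destruct hsg as [-> | ->]; ring. }
assert (H5 : fst w * rh <= cos alpha * ka).
{ apply (Rmult_le_compat_l (cos alpha)) in hka; [|lra].
  replace (cos alpha * (fst w / cos alpha * rh)) with (fst w * rh) in hka by (field; lra).
      exact hka. }
nra.
Qed.

Theorem theorem4 (n : nat) (hn : (1 <= n)%nat) (a0 : R) (ha0 : 0 < a0)
  (mu0 : R) (hmu0 : 0 < mu0 < 1) (hrho : rho n a0 mu0 = sin (PI * mu0 / 2))
  (mu : R) (hmu : 0 < mu < mu0)
  (p : C -> C) (hp : class_H (RtoC a0) n p)
  (hp0 : forall z : C, in_disk z -> p z <> 0%C)
  (harg : forall z : C, in_disk z ->
    abs_arg_lt (p z - z * C_derive p z / p z)%C
      (atan (rho n a0 mu * cos (PI * mu / 2) /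
             (1 - rho n a0 mu * sin (PI * mu / 2))) - PI / 2 * mu)) :
  class_STH (RtoC a0) n mu p.
Proof.
split; [exact hp|]. intros z1 hz1.
destruct hp as [_ [a [aa0 [ak ps]]]].
destruct (cps_derive_sum a p ps) as [D psD].
destruct (cps_derive_sum _ D psD) as [E psE].
destruct (cps_tail_bound a p n hn ps ak) as [M [hM HM]].
assert (p00 := cps_value_0 a p n hn ps ak). rewrite aa0 in HM, p00.
assert (HD : forall z, in_disk z -> cdiff p z (D z) /\ cdiff D z (E z)).
{ intros z hz. split; [apply (cps_cdiff a)|apply (cps_cdiff (cps_derive a))]; assumption. }
assert (PI0 := PI_RGT_0).
replace (PI * mu / 2) with (PI / 2 * mu) in harg by field.
set (alpha := PI / 2 * mu) in *.
assert (ha : 0 < alpha < PI / 2) by (unfold alpha; split; nra).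
assert (ca : 0 < cos alpha) by (apply cos_gt_0; lra).
assert (sa : 0 < sin alpha) by (apply sin_gt_0; lra).
(* In the disk, [g] is positive exactly where [p z] lies in the open sector. *)
set (g := fun z => sin alpha * fst (p z) - cos alpha * Rabs (snd (p z))).
apply sector_abs_arg_lt; [exact ha|now apply hp0|]. fold (g z1).
apply Rnot_le_lt; intro bad.
(* [z0] is where [p] first reaches the boundary of the sector; up to that modulus it stays in the
   closed sector. *)
destruct (first_boundary_point g z1) as [z0 [hz0 [gz0 Hz0]]]; [| |exact hz1|exact bad|].
{ intros z hz eps heps.
  destruct (cdiff_continuous p z _ (proj1 (HD z hz)) (eps / 2) ltac:(lra)) as [d [hd Hd]].
  exists d; split; [exact hd|]. intros w hw. assert (X := Hd w hw).
  destruct (Cmod_ge_abs (p w - p z)%C) as [X1 X2].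
  assert (Y1 : Rabs (fst (p w) - fst (p z)) < eps / 2) by (eapply Rle_lt_trans;
      [exact X1|exact X]).
  assert (Y2 : Rabs (snd (p w) - snd (p z)) < eps / 2) by (eapply Rle_lt_trans;
      [exact X2|exact X]).
  assert (Y3 := Rabs_triang_inv2 (snd (p w)) (snd (p z))).
  assert (Y4 : Rabs (Rabs (snd (p w)) - Rabs (snd (p z))) < eps / 2) by lra.
  assert (SB := SIN_bound alpha). assert (CB := COS_bound alpha).
  apply Rabs_def2 in Y1, Y4. unfold g. apply Rabs_def1; nra. }
{ unfold g. rewrite p00. simpl. rewrite Rabs_R0. nra. }
(* The closed sector meets the closed left half-plane only at 0, a value omitted by [p]. *)
assert (pos : forall z, Cmod z <= Cmod z0 -> 0 < fst (p z)).
{ intros z hz. assert (G := Hz0 z hz). unfold g in G.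
  assert (A := Rabs_pos (snd (p z))).
  destruct (Rle_lt_dec (fst (p z)) 0) as [h|h]; [|exact h]. exfalso.
  assert (B : fst (p z) = 0) by nra. assert (B2 : Rabs (snd (p z)) = 0) by nra.
  apply (hp0 z ltac:(unfold in_disk; lra)).
  destruct (Req_dec (snd (p z)) 0) as [h0|h0]; [|now apply Rabs_no_R0 in h0].
  rewrite (surjective_pairing (p z)), B, h0. reflexivity. }
assert (tan_alpha : cos alpha * tan alpha = sin alpha) by (unfold tan; field; lra).
assert (atl : forall x, Rabs x <= tan alpha -> Rabs (atan x) <= alpha).
{ intros x hx. apply Rabs_le_between in hx.
  assert (I : forall u v, u <= v -> atan u <= atan v) by (intros u v [h| ->]; [left;
      now apply atan_increasing|lra]).
  apply Rabs_le_between. split.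
  - rewrite <- (atan_tan alpha), <- atan_opp by lra. apply I; lra.
  - rewrite <- (atan_tan alpha) by lra. apply I; lra. }
(* Since [alpha / mu = pi / 2], the closed sector becomes the strip [|Y| <= pi / 2]. *)
assert (Yb : forall z, Cmod z <= Cmod z0 -> 0 < fst (p z) /\ Rabs (sectY mu (p z)) <= PI / 2).
{ intros z hz. split; [now apply pos|]. assert (G := Hz0 z hz). assert (Q := pos z hz).
    unfold g in G.
  unfold sectY, Rdiv. rewrite Rabs_mult, (Rabs_pos_eq (/ mu)) by (left; apply Rinv_0_lt_compat;
      lra).
  apply Rmult_le_reg_r with mu; [lra|]. rewrite Rmult_assoc, Rinv_l, Rmult_1_r by lra.
  apply atl. rewrite Rabs_mult, (Rabs_pos_eq (/ fst (p z))) by (left; apply Rinv_0_lt_compat;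
      lra).
  apply Rmult_le_reg_r with (fst (p z)); [lra|]. rewrite Rmult_assoc, Rinv_l, Rmult_1_r by lra.
  apply Rmult_le_reg_l with (cos alpha); [exact ca|].
  replace (cos alpha * (tan alpha * fst (p z))) with (cos alpha * tan alpha * fst (p z)) by
      ring.
  rewrite tan_alpha. lra. }
assert (w1pos := pos z0 ltac:(lra)).
(* [g z0 = 0] puts [p z0] on one of the two boundary rays; [sg] records which. *)
assert (sgn : exists sg, (sg = 1 \/ sg = -1) /\ cos alpha * snd (p z0) = sg * (sin alpha * fst
    (p z0))).
{ unfold g in gz0. destruct (Rle_lt_dec 0 (snd (p z0))) as [h|h].
  - exists 1; split; [now left|]. rewrite Rabs_pos_eq in gz0 by exact h. lra.
  - exists (-1); split; [now right|]. rewrite Rabs_left in gz0 by exact h. lra. }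
destruct sgn as [sg [hsg heq]].
assert (hY : sectY mu (p z0) = sg * (PI / 2)).
{ unfold sectY. replace (snd (p z0) / fst (p z0)) with (sg * tan alpha).
  - destruct hsg as [-> | ->].
    + rewrite !Rmult_1_l, atan_tan by lra. unfold alpha; field; lra.
    + replace (-1 * tan alpha) with (- tan alpha) by ring. rewrite atan_opp, atan_tan by lra.
        unfold alpha; field; lra.
  - apply Rmult_eq_reg_l with (cos alpha * fst (p z0)); [|nra].
    replace (cos alpha * fst (p z0) * (snd (p z0) / fst (p z0))) with (cos alpha * snd (p z0))
        by (field; lra).
    rewrite heq, <- tan_alpha. ring. }
destruct (jack_sector mu a0 M sg n p D E z0 ltac:(lra) ha0 hM hn p00 HM HD hz0 Yb hsg hY) as
    [J1 J2].
assert (hz0d : in_disk z0) by (unfold in_disk; lra).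
assert (H := harg z0 hz0d). rewrite (cdiff_C_derive p z0 _ (proj1 (HD z0 hz0d))) in H.
set (w := p z0) in *. set (l := (z0 * D z0)%C) in *.
set (X := sectX mu a0 w) in *.
set (N := fst w ^ 2 + snd w ^ 2) in *.
assert (Npos : 0 < N) by (unfold N; nra).
set (K := sg * (fst w * snd l - snd w * fst l)) in *.
assert (sg2 : sg * sg = 1) by (destruct hsg as [-> | ->]; ring).
(* By [J1] the quotient [l / w] is purely imaginary, so subtracting it moves [w] vertically. *)
assert (ev : (w - l / w)%C = (fst w, snd w - sg * (K / N))).
{ assert (e1 : fst (l / w)%C = (fst w * fst l + snd w * snd l) / N) by (unfold N; simpl; field;
    fold N; simpl in *; unfold N in Npos; lra).
  assert (e2 : snd (l / w)%C = sg * (K / N)).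
  { replace (sg * (K / N)) with ((sg * sg) * ((fst w * snd l - snd w * fst l) / N)) by (unfold
      K; field; lra).
    rewrite sg2. unfold N; simpl; field; fold N; simpl in *; unfold N in Npos; lra. }
  rewrite J1 in e1. unfold Rdiv in e1 at 1. rewrite Rmult_0_l in e1.
  rewrite (surjective_pairing (w - l / w)%C). f_equal.
  - change (fst w + - fst (l / w)%C = fst w). rewrite e1; ring.
  - change (snd w + - snd (l / w)%C = snd w - sg * (K / N)). rewrite e2; ring. }
rewrite ev in H.
assert (rpos : 0 < rho n a0 mu).
{ unfold rho. apply Rmult_lt_0_compat.
  - apply Rdiv_lt_0_compat; [|lra]. apply Rmult_lt_0_compat; [apply lt_0_INR; lia|lra].
  - apply Rplus_lt_0_compat; apply exp_pos. }
revert H. apply boundary_value_excluded; trivial.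
(* [fst w / cos alpha] is [Cmod w = a0 * exp (mu * X)] *)
assert (modw : fst w / cos alpha = a0 * exp (mu * X)).
{ assert (wne : w <> 0%C) by now apply hp0.
  assert (e1 : a0 * exp (mu * X) = Cmod w).
  { unfold X, sectX. rewrite ln_Cmod by exact wne.
    replace (mu * ((2 * ln (Cmod w) / 2 - ln a0) / mu)) with (ln (Cmod w) - ln a0) by (field;
        lra).
    rewrite <- ln_div by (trivial; now apply Cmod_gt_0).
    rewrite exp_ln; [field; lra|]. apply Rdiv_lt_0_compat; trivial; now apply Cmod_gt_0. }
  rewrite e1. apply Rsqr_inj; [left; now apply Rdiv_lt_0_compat|apply Cmod_ge_0|].
  replace (Cmod w)² with (Cmod w ^ 2) by (unfold Rsqr; ring). rewrite Cmod_sqr.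
  apply Rmult_eq_reg_l with (cos alpha ^ 2); [|nra].
  replace (cos alpha ^ 2 * (fst w ^ 2 + snd w ^ 2)) with ((cos alpha * fst w) ^ 2 + (cos alpha
      * snd w) ^ 2) by ring.
  rewrite heq. assert (P := sin2_cos2 alpha). unfold Rsqr in P |- *.
  replace (cos alpha ^ 2 * (fst w / cos alpha * (fst w / cos alpha))) with (fst w ^ 2) by
      (field; lra).
  replace ((sg * (sin alpha * fst w)) ^ 2) with (sg * sg * ((sin alpha * fst w) ^ 2)) by ring.
      rewrite sg2.
  replace ((cos alpha * fst w) ^ 2 + 1 * (sin alpha * fst w) ^ 2) with ((sin alpha * sin alpha
      + cos alpha * cos alpha) * fst w ^ 2) by ring.
  rewrite P; ring. }
rewrite modw.
(* Multiplying the exponentials of [rho_le] by [exp (mu * X)] gives [2 cosh X], which links the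
   minimum defining [rho] to the bound of [jack_sector]. *)
apply Rle_trans with (INR n * mu * cosh X).
- assert (R := rho_le n a0 mu X ha0 ltac:(lra)).
  apply (Rmult_le_compat_l (a0 * exp (mu * X))) in R; [|left; apply Rmult_lt_0_compat;
      [lra|apply exp_pos]].
  eapply Rle_trans; [exact R|]. right.
  replace (a0 * exp (mu * X) * (INR n * mu / (2 * a0) * (exp ((1 - mu) * X) + exp (- ((1 + mu)
      * X)))))
   with (INR n * mu * ((exp (mu * X) * exp ((1 - mu) * X) + exp (mu * X) * exp (- ((1 + mu) *
       X))) / 2)) by (field; lra).
  rewrite <- !exp_plus. unfold cosh. do 4 f_equal; ring.
- apply Rmult_le_reg_r with N; [exact Npos|]. replace (K / N * N) with K by (field; lra).
    exact J2.
Qed.
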